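(* Let $r>0$ and let $X_1$ and $X_2$ be independent $\Gamma(r,1)$ random variables. For $\alpha\in\mathbb{R}$ let $Z_\alpha = \alpha X_1 + (2-\alpha)X_2$. Then the function $\alpha\mapsto \operatorname{Med}(Z_\alpha)$ is strictly decreasing on $(2,\infty)$.
   Context: For $r>0$ and $\lambda>0$, $\Gamma(r,\lambda)$ denotes the gamma distribution with shape $r$ and rate $\lambda$, i.e. with density $\frac{\lambda^r}{\Gamma(r)}x^{r-1}e^{-\lambda x}$, $x>0$. The median of a real-valued random variable $X$ is $\operatorname{Med}(X)=\inf\{x\in\mathbb{R}: P(X\le x)\ge 1/2\}$. *)

(* Defs.v *)
From HB Require Import structures.
From mathcomp Require Import all_boot all_order all_algebra.
From mathcomp Require Import all_classical all_reals all_analysis.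
From mathcomp Require Import measurable_realfun.

Set Implicit Arguments.
Unset Strict Implicit.
Unset Printing Implicit Defensive.

Import Order.TTheory GRing.Theory Num.Theory.
Import numFieldNormedType.Exports.

Local Open Scope classical_set_scope.
Local Open Scope ring_scope.

Section gamma_distribution.
Context {R : realType}.
Notation mu := (@lebesgue_measure R).

Definition gamma_fun (r : R) : R :=
  \int[mu]_(x in `]0, +oo[) (x `^ (r - 1) * expR (- x)).

Definition gamma_pdf (r rate : R) : R -> R :=
  (fun x => rate `^ r / gamma_fun r * x `^ (r - 1) * expR (- rate * x))
    \_ `]0, +oo[.

Definition gamma_prob (r rate : R) (A : set R) : \bar R :=
  (\int[mu]_(x in A) (gamma_pdf r rate x)%:E)%E.

End gamma_distribution.

Section random_variables.
Context {d : measure_display} {T : measurableType d} {R : realType}.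
Variable P : probability T R.

(* The laws are compared on Borel sets only: outside of them, the Lebesgue
   integral defining gamma_prob has no meaning. *)
Definition gamma_distributed (r rate : R) (X : {RV P >-> R}) : Prop :=
  forall A : set R, measurable A -> distribution P X A = gamma_prob r rate A.

Definition independent_RV (X Y : {RV P >-> R}) : Prop :=
  forall A B : set R, measurable A -> measurable B ->
    P (X @^-1` A `&` Y @^-1` B) = (P (X @^-1` A) * P (Y @^-1` B))%E.

Definition Med (X : {RV P >-> R}) : R :=
  inf [set x : R | ((2^-1)%:E <= cdf X x)%E].

End random_variables.

(* Main.v *)
Require Import Defs.
From HB Require Import structures.
From mathcomp Require Import all_boot all_order all_algebra.
From mathcomp Require Import all_classical all_reals all_analysis.
From mathcomp Require Import measurable_realfun.
From mathcomp Require Import ring lra.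

(** Write alpha = 2 / t with 0 < t < 1 and m = 2 c.  For c >= 0,
      P(Z_alpha <= m) = P(X1 <= X2 + t (c - X2))
                      = int_0^oo f(y) G(y + t (c - y)) dy =: phi c t,
    where f and G are the gamma density and distribution function
    ([probability_combination]).  As t decreases to 0, that is, as alpha grows
    to infinity, phi c t tends to phi c 0 = 1/2 for every c, because f G is
    the derivative of G^2 / 2.  It is therefore enough to know that, c > 0
    being fixed, phi c is either monotone or first increasing, then decreasing
    in t: if phi c is at least 1/2 at some u < 1, then it exceeds 1/2 on
    the whole interval ]0, u[ ([phi_gt_half]).  Take for m the median of Z_a.
    It is positive ([phi_origin_lt_half]), and for b > a the value
    P(Z_b <= m) is larger than 1/2; by continuity in m ([phi_lipschitz]) it is
    still at least 1/2 slightly to the left of m, so that Med Z_b < m.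

    The shape of phi c rests on the sign of its derivative.  Put
    p = 1 / t - 1 and y = c s / p.  Then, up to a positive factor, minus the
    derivative of phi c at t is
      E(p) = I_1(k) - p I_0(k),  k = c (1 / p + 1 / (1 + p)),
      I_j(k) = int_0^oo s^j (s (1 + s))^(r-1) e^(- k s) ds
    ([dphi_balance]).  Since I_j' = - I_(j+1), and since integration by parts
    expresses I_2 through I_0 and I_1 ([wint_recurrence]), the function E
    solves a first-order linear differential equation.  With the integrating
    factor q it becomes
      (q E)' = q I_0(k) ((r - c) (2 + 1 / (p (1 + p))) - 1)
    ([is_derive_factor_balance]).  The last factor changes sign at most once
    on ]0, +oo[, from positive to negative, and q E is at least - K p near 0.
    Hence E too can only change sign from positive to negative
    ([balance_single_crossing]). *)

Set Implicit Arguments.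
Unset Strict Implicit.
Unset Printing Implicit Defensive.

Import Order.TTheory GRing.Theory Num.Theory.
Import numFieldNormedType.Exports.

Local Open Scope classical_set_scope.
Local Open Scope ring_scope.

(** * Integrals over the positive half-line *)

Section toolbox.
Context {R : realType}.
Notation mu := (@lebesgue_measure R).
Implicit Types (a k x : R) (f h Q : R -> R).

Lemma ln_leB1 x : 0 < x -> ln x <= x - 1.
Proof.
move=> x0; rewrite -[X in ln X](_ : 1 + (x - 1) = x);
  last by rewrite addrCA subrr addr0.
by apply: le_ln1Dx; rewrite ltrBrDl subrr.
Qed.

(** Everything below is dominated through this bound: the logarithm of the
    left-hand side is a * ln (1 + x) - k x, and ln z <= z - 1 at
    z = (k / a) (1 + x) makes it bounded. *)
Lemma powR1D_expR_bounded a k : 0 < k -> exists2 C, 0 < C &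
  forall x, 0 <= x -> (1 + x) `^ a * expR (- (k * x)) <= C.
Proof.
move=> k0; have [a0|a0] := leP a 0.
  exists 1 => // x x0; rewrite -[leRHS]mulr1 ler_pM ?powR_ge0 ?expR_ge0//.
    rewrite /powR gt_eqF ?ltr_pwDl// -[leRHS]expR0 ler_expR mulr_le0_ge0//.
    by rewrite ln_ge0// lerDl.
  by rewrite -[leRHS]expR0 ler_expR oppr_le0 mulr_ge0// ltW.
exists (expR (k - a - a * ln (k / a))); first exact: expR_gt0.
move=> x x0; rewrite /powR gt_eqF ?ltr_pwDl// -expRD ler_expR.
have x1 : 0 < 1 + x by rewrite ltr_pwDl.
have ka : 0 < k / a by rewrite divr_gt0.
have := @ln_leB1 (k / a * (1 + x)) (mulr_gt0 ka x1).
rewrite lnM ?posrE// => H.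
have := ler_wpM2l (ltW a0) H.
have -> : a * (k / a * (1 + x) - 1) = k * (1 + x) - a by field; rewrite gt_eqF.
lra.
Qed.

Lemma pos_bigcup_itv :
  \bigcup_n [set` `[n.+1%:R^-1, +oo[] = [set` `]0, +oo[] :> set R.
Proof.
apply/seteqP; split => x /=.
  by move=> [n _] /=; rewrite !in_itv/= !andbT; apply: lt_le_trans.
rewrite in_itv/= andbT => x0.
exists (Num.truncn x^-1) => //=; rewrite in_itv/= andbT.
rewrite invf_ple ?posrE//.
by apply/ltW/truncnS_gt.
Qed.

Lemma measurable_fun_pos h : (forall x, 0 < x -> {for x, continuous h}) ->
  measurable_fun (`]0, +oo[%classic : set (measurableTypeR R)) h.
Proof.
move=> ch; apply: open_continuous_measurable_fun => // x.
by rewrite inE/= in_itv/= andbT; exact: ch.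
Qed.

Lemma is_derive_continuous f x df : is_derive x 1 f df -> {for x, continuous f}.
Proof. by case=> /derivable1_diffP/differentiable_continuous. Qed.

(** An improper fundamental theorem of calculus in which the integrand may be
    singular at 0, as the gamma density is when r < 1: it is applied on
    [1 / (n + 1), +oo[, and n tends to infinity. *)
Lemma ge0_integral_derive Q h l0 l1 :
  (forall x, 0 < x -> 0 <= h x) ->
  (forall x, 0 < x -> {for x, continuous h}) ->
  (forall x, 0 < x -> is_derive x 1 Q (h x)) ->
  Q x @[x --> 0^'+] --> l0 -> Q x @[x --> +oo] --> l1 ->
  (\int[mu]_(x in `]0%R, +oo[) (h x)%:E = (l1 - l0)%:E)%E.
Proof.
move=> h0 ch dQ Q0 Q1.
have cvgI : (\int[mu]_(x in `[n.+1%:R^-1%R, +oo[) (h x)%:E @[n --> \oo] -->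
    \int[mu]_(x in `]0%R, +oo[) (h x)%:E)%E.
  rewrite -pos_bigcup_itv.
  have sub n : [set` `[n.+1%:R^-1, +oo[] `<=` ([set` `]0, +oo[] : set R).
    by apply: subset_itvr; rewrite bnd_simp.
  apply: ge0_nondecreasing_set_cvg_integral => //=.
  - move=> m n mn; apply/subsetPset; apply: subset_itvr.
    by rewrite bnd_simp lef_pV2 ?posrE// ler_nat.
  - move=> n; apply/measurable_EFinP; apply: measurable_funS (sub n) _ => //.
    exact: measurable_fun_pos.
  - by move=> n x /sub; rewrite /= in_itv/= andbT lee_fin; exact: h0.
have eI n : (\int[mu]_(x in `[n.+1%:R^-1%R, +oo[) (h x)%:E =
    (l1 - Q n.+1%:R^-1)%:E)%E.
  have n0 : 0 < n.+1%:R^-1 :> R by [].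
  rewrite (@ge0_continuous_FTC2y _ h Q _ l1) ?EFinB//.
  - by move=> x nx; apply: h0; exact: lt_le_trans nx.
  - apply: continuous_in_subspaceT => x; rewrite inE/= in_itv/= andbT => nx.
    by apply: ch; exact: lt_le_trans nx.
  - by move=> x nx; have [] := dQ x (lt_trans n0 nx).
  - by apply: cvg_at_right_filter; exact: is_derive_continuous (dQ _ n0).
  - move=> x; rewrite in_itv/= andbT => nx.
    by rewrite derive1E; have [_ ->] := dQ x (lt_trans n0 nx).
have cvgQ : ((l1 - Q n.+1%:R^-1)%:E @[n --> \oo] --> (l1 - l0)%:E)%E.
  apply: cvg_EFin; first exact: nearW.
  apply: cvgB; first exact: cvg_cst.
  have /cvg_at_rightP H := Q0.
  apply: (H (fun n => n.+1%:R^-1)); split => //.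
  exact: cvg_harmonic.
have := cvgI; under eq_cvg do rewrite eI.
by move=> /cvg_unique; apply.
Qed.

Lemma measurable_scale (l : R) : measurable_fun [set: measurableTypeR R]
  ( *%R l : measurableTypeR R -> measurableTypeR R).
Proof. exact: mulrl_measurable. Qed.

(** The image under x |-> l x of l times Lebesgue measure; uniqueness of
    Lebesgue measure identifies it with Lebesgue measure itself. *)
Definition scaled_lebesgue (l : R) (l0 : 0 < l) :
    {measure set (measurableTypeR R) -> \bar R} :=
  mscale (NngNum (ltW l0))
    (measure_function_pushforward__canonical__measure_function_Measure
       mu (measurable_scale l)).

Lemma lebesgue_measure_scale (l : R) (l0 : 0 < l) (A : set R) : measurable A ->
  mu A = scaled_lebesgue l0 A.
Proof.
move=> mA.
apply: lebesgue_measure_unique => // X [[a b]/= _ <-].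
rewrite /scaled_lebesgue /mscale/= /pushforward.
have -> : *%R l @^-1` `]a, b] = [set` `]a / l, b / l]].
  by apply/seteqP; split => x /=;
    rewrite !in_itv/= ltr_pdivrMr// ler_pdivlMr// ![x * _]mulrC.
rewrite !lebesgue_measure_itv/= !lte_fin ltr_pM2r ?invr_gt0//.
case: ifPn => // _; last by rewrite mule0.
by rewrite -!EFinB -EFinM; congr (_%:E); field; rewrite gt_eqF.
Qed.

Lemma ge0_integral_scale (l : R) (h : R -> R) : 0 < l ->
  measurable_fun (`]0, +oo[%classic : set (measurableTypeR R)) h ->
  (forall x, 0 < x -> 0 <= h x) ->
  (\int[mu]_(x in `]0%R, +oo[) (h x)%:E =
   l%:E * \int[mu]_(x in `]0%R, +oo[) (h (l * x))%:E)%E.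
Proof.
move=> l0 mh h0.
have mE : measurable_fun (`]0, +oo[%classic : set (measurableTypeR R)) (EFin \o
  h).
  exact/measurable_EFinP.
rewrite (eq_measure_integral (scaled_lebesgue l0)); last first.
  by move=> A mA _; exact: lebesgue_measure_scale.
rewrite ge0_integral_mscale//=; last by move=> x; rewrite in_itv/= andbT => /h0.
congr (_ * _)%E.
rewrite (ge0_integral_pushforward (measurable_scale l))//; last first.
  by move=> x; rewrite inE/= in_itv/= andbT lee_fin => /h0.
have -> // : *%R l @^-1` `]0, +oo[ = [set` `]0, +oo[].
by apply/seteqP; split => x /=; rewrite !in_itv/= !andbT pmulr_rgt0.
Qed.

End toolbox.

(** * Derivatives of explicit functions *)

Section derivative_rules.
Context {R : realType}.
Implicit Types (f g : R -> R) (x df dg : R).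

(** Bridges to the difference quotient in the form produced by
    differentiation under the integral sign. *)
Lemma cvg_is_derive f x df :
  h^-1 *: (f (h + x) - f x) @[h --> 0^'] --> df -> is_derive x 1 f df.
Proof.
move=> H; split; last first.
  by apply/cvg_lim => //; under eq_fun do rewrite /= scaler1.
by apply/cvg_ex; exists df; under eq_fun do rewrite /= scaler1.
Qed.

(** The product, sum, difference and scaling rules are restated for pointwise
    lambda expressions, with the derivative written with ring operations, so
    that [ring] and [field] can close the resulting equations. *)
Lemma is_deriveMf f g x df dg : is_derive x 1 f df -> is_derive x 1 g dg ->
  is_derive x 1 (fun y => f y * g y) (df * g x + f x * dg).
Proof.
move=> Hf Hg; apply: is_derive_eq (is_deriveM Hf Hg) _.
by rewrite /GRing.scale/= addrC mulrC [f x * _]mulrC [dg * _]mulrC.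
Qed.

Lemma is_deriveDf f g x df dg : is_derive x 1 f df -> is_derive x 1 g dg ->
  is_derive x 1 (fun y => f y + g y) (df + dg).
Proof. by move=> Hf Hg; exact: is_deriveD. Qed.

Lemma is_deriveBf f g x df dg : is_derive x 1 f df -> is_derive x 1 g dg ->
  is_derive x 1 (fun y => f y - g y) (df - dg).
Proof. by move=> Hf Hg; exact: is_deriveB. Qed.

Lemma is_deriveCf (c : R) f x df : is_derive x 1 f df ->
  is_derive x 1 (fun y => c * f y) (c * df).
Proof. by move=> Hf; exact: is_deriveZ. Qed.

Lemma is_derive_exp_comp f x df : is_derive x 1 f df ->
  is_derive x 1 (fun y => expR (f y)) (df * expR (f x)).
Proof.
by move=> Hf; apply: is_derive_eq (is_derive1_comp (is_derive_expR _) Hf) _;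
  rewrite mulrC.
Qed.

Lemma is_derive_ln_comp f x df : 0 < f x -> is_derive x 1 f df ->
  is_derive x 1 (fun y => ln (f y)) (df / f x).
Proof.
by move=> f0 Hf; apply: is_derive_eq (is_derive1_comp (is_derive1_ln f0) Hf) _;
  rewrite mulrC.
Qed.

Lemma is_derive_powR_comp (a : R) f x df : 0 < f x -> is_derive x 1 f df ->
  is_derive x 1 (fun y => f y `^ a) (a * f x `^ (a - 1) * df).
Proof.
by move=> f0 Hf; exact: (is_derive1_comp (is_derive1_powR a f0) Hf).
Qed.

Lemma is_deriveVf f x df : f x != 0 -> is_derive x 1 f df ->
  is_derive x 1 (fun y => (f y)^-1) (- (df / f x ^+ 2)).
Proof.
move=> f0 Hf; apply: is_derive_eq (is_deriveV f0 Hf) _.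
by rewrite /GRing.scale/= mulNr mulrC.
Qed.

Lemma is_derive_addl (c : R) x : is_derive x 1 (fun y => c + y) 1.
Proof.
by apply: is_derive_eq (is_deriveDf (is_derive_cst c x 1) (is_derive_id x 1)) _;
  rewrite add0r.
Qed.

Lemma is_derive_exp_linear (l x : R) :
  is_derive x 1 (fun y => expR (- (l * y))) (- l * expR (- (l * x))).
Proof.
apply: is_derive_exp_comp.
apply: is_derive_eq (is_deriveN (is_deriveCf l (is_derive_id x 1))) _.
by rewrite mulr1.
Qed.

Lemma continuous_expRN x : {for x, continuous (fun y : R => expR (- y))}.
Proof.
have := is_derive_continuous (is_derive_exp_linear 1 x).
have -> // : (fun y => expR (- (1 * y))) = (fun y : R => expR (- y)).
by apply/funext => y; rewrite mul1r.
Qed.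

Lemma continuous_comp_at (f g : R -> R) x :
  {for x, continuous f} -> {for f x, continuous g} ->
    {for x, continuous (fun y => g (f y))}.
Proof. exact: continuous_comp. Qed.

End derivative_rules.

Section integral_positivity.
Context {R : realType}.
Notation mu := (@lebesgue_measure R).

(** An integrand with a null integral vanishes almost everywhere, whereas the
    half-line has infinite measure. *)
Lemma Rintegral_pos_gt0 (h : R -> R) :
  mu.-integrable `]0, +oo[ (EFin \o h) -> (forall x, 0 < x -> 0 < h x) ->
  0 < \int[mu]_(x in `]0, +oo[) h x.
Proof.
move=> ih h0.
have mD : measurable (`]0, +oo[%classic : set (measurableTypeR R)) by [].
have mh : measurable_fun (`]0, +oo[%classic : set (measurableTypeR R)) (EFin \o
  h).
  by case/integrableP : ih.
rewrite lt_neqAle Rintegral_ge0 ?andbT; last first.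
  by move=> x; rewrite /= in_itv/= andbT => /h0/ltW.
apply/eqP => I0.
have : (\int[mu]_(x in `]0%R, +oo[) `|(EFin \o h) x| = 0)%E.
  transitivity (\int[mu]_(x in `]0%R, +oo[) (EFin \o h) x)%E.
    apply: eq_integral => x; rewrite inE/= in_itv/= andbT => /h0 hx.
    by rewrite ger0_norm// ltW.
  by move: (integrable_fin_num mD ih) => /fineK <-;
    rewrite -/(Rintegral _ _ _) -I0.
move=> /(proj1 (ae_eq_integral_abs mu mD mh)) [N [mN N0 sN]].
suff : (mu `]0%R, +oo[ <= mu N)%E.
  by rewrite N0 lebesgue_measure_itv/= ltry.
apply: le_measure; rewrite ?inE//.
apply: subset_trans sN => x /= x0; apply/not_implyP; split => //=.
by move: x0; rewrite in_itv/= andbT => /h0 hx [] hx0; rewrite hx0 ltxx in hx.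
Qed.

End integral_positivity.

(** * The integrals I_j and their recurrence *)

Section kernel_integrals.
Context {R : realType}.
Notation mu := (@lebesgue_measure R).
Variable r : R.
Hypothesis r0 : 0 < r.
Implicit Types (k : nat) (l s : R).

(** A dominating function that has an explicit primitive, (s / (1 + s))^r / r,
    and hence an explicit integral; it has the order of magnitude s^(r-1) of
    the gamma integrands at 0. *)
Definition envelope s : R := s `^ (r - 1) * (1 + s) `^ (- r - 1).

(** [wint k l] is, up to elementary factors, a modified Bessel function of the
    second kind when k = 0.  The power of s (1 + s) is kept as a product of two
    powers, which avoids side conditions when it is differentiated. *)
Definition wgt k l s : R :=
  s ^+ k * (s `^ (r - 1) * (1 + s) `^ (r - 1)) * expR (- (l * s)).

Definition wint k l : R := \int[mu]_(s in `]0, +oo[) wgt k l s.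

Lemma envelope_gt0 s : 0 < s -> 0 < envelope s.
Proof. by move=> s0; rewrite mulr_gt0// powR_gt0// ltr_pwDl// ltW. Qed.

Lemma wgt_gt0 k l s : 0 < s -> 0 < wgt k l s.
Proof.
by move=> s0; rewrite !mulr_gt0 ?expR_gt0 ?powR_gt0 ?exprn_gt0// ltr_pwDl// ltW.
Qed.

Lemma continuous_powRf (a s : R) : 0 < s ->
  {for s, continuous (fun y : R => y `^ a)}.
Proof. by move=> s0; exact: is_derive_continuous (is_derive1_powR a s0). Qed.

Lemma continuous_powR1D (a s : R) : 0 < s ->
  {for s, continuous (fun y : R => (1 + y) `^ a)}.
Proof.
move=> s0; have := @is_derive_powR_comp R a (fun y => 1 + y) s 1.
by move=> /(_ (addr_gt0 ltr01 s0) (is_derive_addl _ _));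
  exact: is_derive_continuous.
Qed.

Lemma continuous_envelope s : 0 < s -> {for s, continuous envelope}.
Proof. by move=> s0; apply: cvgM;
  [exact: continuous_powRf|exact: continuous_powR1D]. Qed.

Lemma continuous_wgt k l s : 0 < s -> {for s, continuous (wgt k l)}.
Proof.
move=> s0; apply: cvgM; [apply: cvgM; [|apply: cvgM]|].
- exact: exprn_continuous.
- exact: continuous_powRf.
- exact: continuous_powR1D.
- exact: is_derive_continuous (is_derive_exp_linear l s).
Qed.

Lemma cvg_ratio1D : s / (1 + s) @[s --> +oo] --> (1 : R).
Proof.
have V0 : (1 + s)^-1 @[s --> +oo] --> (0 : R).
  apply/(gtr0_cvgV0 (f := fun s : R => 1 + s)); last exact: cvg_addrl.
  by near=> s; rewrite ltr_pwDl.
have : 1 - (1 + s)^-1 @[s --> +oo] --> (1 - 0 : R).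
  by apply: cvgB => //; exact: cvg_cst.
rewrite subr0; apply: cvg_trans; apply: near_eq_cvg.
near=> s; have s1 : 1 + s != 0 by rewrite gt_eqF// ltr_pwDl.
by field.
Unshelve. all: by end_near. Qed.

Lemma is_derive_envelope_primitive s : 0 < s ->
  is_derive s 1 (fun s => s `^ r * (1 + s) `^ (- r)) (r * envelope s).
Proof.
move=> s0; have s1 : 0 < 1 + s by rewrite ltr_pwDl// ltW.
apply: is_derive_eq (is_deriveMf (is_derive1_powR r s0)
  (is_derive_powR_comp (- r) s1 (is_derive_addl 1 s))) _.
rewrite /envelope -(mulr_powRB1 (ltW s0) r0).
have -> : (1 + s) `^ (- r) = (1 + s) * (1 + s) `^ (- r - 1).
  rewrite -{2}[1 + s]powRr1 ?(ltW s1)// -powRD; last by apply/implyP => _;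
    rewrite gt_eqF.
  by congr (_ `^ _); ring.
by ring.
Qed.

Lemma cvg_powRM_right0 (a : R) : s `^ r *
  (1 + s) `^ a @[s --> 0^'+] --> (0 : R).
Proof.
rewrite -[X in _ --> X](mul0r ((1 + 0) `^ a : R)); apply: cvgM.
  exact: powR_cvg0.
apply: cvg_at_right_filter.
apply: (@continuous_comp_at _ (fun y => 1 + y) (fun y => y `^ a)).
  exact: is_derive_continuous (is_derive_addl _ _).
by apply: continuous_powRf; rewrite addr0.
Qed.

Lemma cvg_envelope_primitive_pinfty :
  s `^ r * (1 + s) `^ (- r) @[s --> +oo] --> (1 : R).
Proof.
have H : (s / (1 + s)) `^ r @[s --> +oo] --> (1 `^ r : R).
  apply: (@cvg_comp _ _ _ (fun s => s / (1 + s)) (fun y => y `^ r) _ _ _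
    cvg_ratio1D).
  by have := @continuous_powRf r 1 ltr01; rewrite /prop_for.
rewrite powR1 in H; apply: cvg_trans H; apply: near_eq_cvg.
near=> s; rewrite powRM ?invr_ge0 ?addr_ge0 ?ler01//.
by rewrite -powR_inv1 ?addr_ge0 ?ler01// -powRrM mulN1r.
Unshelve. all: by end_near. Qed.

Lemma integral_envelope :
  (\int[mu]_(s in `]0%R, +oo[) (r * envelope s)%:E = 1)%E.
Proof.
have H := @ge0_integral_derive R (fun s => s `^ r * (1 + s) `^ (- r))
  (fun s => r * envelope s) 0 1.
rewrite subr0 in H; apply: H.
- by move=> s s0; rewrite mulr_ge0 ?(ltW r0)// ltW// envelope_gt0.
- move=> s s0; apply: cvgM; first exact: cvg_cst.
  exact: continuous_envelope.
- exact: is_derive_envelope_primitive.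
- exact: cvg_powRM_right0.
- exact: cvg_envelope_primitive_pinfty.
Qed.

Lemma integrable_envelope : mu.-integrable `]0, +oo[ (EFin \o envelope).
Proof.
have mD : measurable (`]0, +oo[%classic : set (measurableTypeR R)) by [].
have me : measurable_fun (`]0, +oo[%classic : set (measurableTypeR R)) (EFin \o
  envelope).
  by apply/measurable_EFinP; apply: measurable_fun_pos;
    exact: continuous_envelope.
suff : mu.-integrable `]0, +oo[ (EFin \o (fun s => r * envelope s)).
  move=> /(integrableZl mD r^-1); apply: eq_integrable => // s _.
  by rewrite /= -EFinM mulKf// gt_eqF.
apply/integrableP; split.
  apply/measurable_EFinP; apply: measurable_funM => //.
  exact/measurable_EFinP.
under eq_integral => s.
  rewrite inE/= in_itv/= andbT => s0.
  rewrite ger0_norm; last by rewrite mulr_ge0 ?(ltW r0)// ltW// envelope_gt0.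
  over.
by rewrite integral_envelope ltry.
Qed.

Lemma Rintegral_envelope : \int[mu]_(s in `]0, +oo[) (r * envelope s) = 1.
Proof. by rewrite /Rintegral integral_envelope. Qed.

Lemma wgt_le_envelope k l : 0 < l -> exists2 C, 0 < C &
  forall s, 0 < s -> wgt k l s <= C * envelope s.
Proof.
move=> l0; have [C C0 HC] := powR1D_expR_bounded (k%:R + 2 * r) l0.
exists C => // s s0.
have s1 : 0 < 1 + s by rewrite ltr_pwDl// ltW.
apply: le_trans (ler_wpM2r (ltW (envelope_gt0 s0)) (HC _ (ltW s0))).
rewrite /wgt /envelope.
have -> : (1 + s) `^ (r - 1) = (1 + s) `^ (2 * r) * (1 + s) `^ (- r - 1).
  rewrite -powRD; last by apply/implyP => _; rewrite gt_eqF.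
  by congr (_ `^ _); ring.
have -> : (1 + s) `^ (k%:R + 2 * r) = (1 + s) ^+ k * (1 + s) `^ (2 * r).
  rewrite powRD ?powR_mulrn// ?(ltW s1)//.
  by apply/implyP => _; rewrite gt_eqF.
pose W := (1 + s) `^ (2 * r) * expR (- (l * s)) *
  (s `^ (r - 1) * (1 + s) `^ (- r - 1)).
rewrite [leLHS](_ : _ = s ^+ k * W); last by rewrite /W; ring.
rewrite [leRHS](_ : _ = (1 + s) ^+ k * W); last by rewrite /W; ring.
apply: ler_wpM2r; first by rewrite !mulr_ge0 ?powR_ge0 ?expR_ge0.
by apply: lerXn2r; rewrite ?nnegrE ?(ltW s0) ?(ltW s1)// lerDr.
Qed.

Lemma integrable_wgt k l : 0 < l -> mu.-integrable `]0, +oo[ (EFin \o wgt k l).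
Proof.
move=> l0; have [C C0 HC] := wgt_le_envelope k l0.
have mD : measurable (`]0, +oo[%classic : set (measurableTypeR R)) by [].
apply: (le_integrable mD _ _ (integrableZl mD C integrable_envelope)) => /=.
  apply/measurable_EFinP; apply: measurable_fun_pos => s; exact: continuous_wgt.
move=> s; rewrite in_itv/= andbT => s0.
rewrite lee_fin (ger0_norm (ltW (wgt_gt0 k l s0))) ger0_norm ?HC//.
by rewrite mulr_ge0 ?(ltW C0)// ltW// envelope_gt0.
Qed.

Lemma wint_gt0 k l : 0 < l -> 0 < wint k l.
Proof.
by move=> l0; apply: Rintegral_pos_gt0 => [|s s0];
  [exact: integrable_wgt|exact: wgt_gt0].
Qed.

Lemma wgt_le k l l' s : l <= l' -> 0 < s -> wgt k l' s <= wgt k l s.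
Proof.
move=> ll s0; rewrite ler_wpM2l//.
  by rewrite !mulr_ge0 ?powR_ge0 ?exprn_ge0// ltW.
by rewrite ler_expR lerN2 ler_wpM2r// ltW.
Qed.

Lemma wint_le k l l' : 0 < l -> l <= l' -> wint k l' <= wint k l.
Proof.
move=> l0 ll; apply: le_Rintegral => //.
- exact/integrable_wgt/(lt_le_trans l0).
- exact: integrable_wgt.
- by move=> s; rewrite /= in_itv/= andbT => s0; exact: wgt_le.
Qed.

Lemma wgtS k l s : wgt k.+1 l s = s * wgt k l s.
Proof. by rewrite /wgt exprS !mulrA. Qed.

Lemma is_derive_wgt k l s : is_derive l 1 (fun l => wgt k l s) (- wgt k.+1 l s).
Proof.
have H : is_derive l 1 (fun l => expR (- (l * s))) (- s * expR (- (l * s))).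
  have := is_derive_exp_linear s l.
  have -> : (fun y => expR (- (s * y))) = (fun l => expR (- (l * s))).
    by apply/funext => y; rewrite mulrC.
  by rewrite [s * l]mulrC.
apply: is_derive_eq (is_deriveCf _ H) _.
by rewrite wgtS /wgt; ring.
Qed.

(** On ]l / 2, l + 1[ the derivative of the integrand is dominated by
    [wgt k.+1 (l / 2)], because [wgt] decreases in the exponential rate. *)
Lemma is_derive_wint k l : 0 < l -> is_derive l 1 (wint k) (- wint k.+1 l).
Proof.
move=> l0.
have mD : measurable (`]0, +oo[%classic : set (measurableTypeR R)) by [].
have dE l' s : partial1of2 (wgt k) l' s = - wgt k.+1 l' s.
  by rewrite partial1of2E; have [_ ->] := is_derive_wgt k l' s.
have l20 : 0 < l / 2 by rewrite divr_gt0.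
have int2 : mu.-integrable `]0, +oo[ (EFin \o (fun s => `|wgt k.+1 (l / 2) s|)).
  exact: (integrable_norm (integrable_wgt k.+1 l20)).
have Il : `]l / 2, l + 1[%classic l.
  by rewrite /= in_itv/= ltrDl ltr01 andbT; lra.
have key := @cvg_differentiation_under_integral R _ _ mu (wgt k) `]0, +oo[ mD
  l (l / 2) (l + 1) Il _ _ _ (fun s => normr_ge0 _) int2 _.
have {key}: h^-1 *: (wint k (h + l) - wint k l) @[h --> 0^'] --> - wint k.+1 l.
  have -> : - wint k.+1 l = \int[mu]_(s in `]0, +oo[) partial1of2 (wgt k) l s.
    under eq_Rintegral do rewrite dE -mulN1r.
    by rewrite RintegralZl ?mulN1r//; exact: integrable_wgt.
  apply: key.
  - move=> x; rewrite /= in_itv/= => /andP[lx _]; apply: integrable_wgt.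
    exact: lt_trans lx.
  - by move=> x s _ _; have [] := is_derive_wgt k x s.
  - move=> x s; rewrite /= !in_itv/= andbT => /andP[lx _] s0.
    rewrite dE normrN !(ger0_norm (ltW (wgt_gt0 _ _ s0))).
    by apply: wgt_le => //; exact: ltW.
exact: cvg_is_derive.
Qed.

End kernel_integrals.

Section recurrence.
Context {R : realType}.
Notation mu := (@lebesgue_measure R).
Variable r : R.
Hypothesis r0 : 0 < r.
Implicit Types (k : nat) (l s : R).

Lemma integrableDf (f g : R -> R) :
  mu.-integrable `]0, +oo[ (EFin \o f) ->
    mu.-integrable `]0, +oo[ (EFin \o g) ->
  mu.-integrable `]0, +oo[ (EFin \o (fun s => f s + g s)).
Proof. by move=> hf hg; exact: (integrableD _ hf hg). Qed.

Lemma integrableCf (a : R) (f : R -> R) :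
  mu.-integrable `]0, +oo[ (EFin \o f) ->
  mu.-integrable `]0, +oo[ (EFin \o (fun s => a * f s)).
Proof. by move=> hf; exact: (integrableZl _ a hf). Qed.

Lemma is_derive_wgt_primitive l s : 0 < s ->
  is_derive s 1 (fun s => s `^ r * (1 + s) `^ r * expR (- (l * s)))
   (r * wgt r 0 l s + (2 * r - l) * wgt r 1 l s - l * wgt r 2 l s).
Proof.
move=> s0; have s1 : 0 < 1 + s by rewrite ltr_pwDl// ltW.
apply: is_derive_eq (is_deriveMf (is_deriveMf (is_derive1_powR r s0)
  (is_derive_powR_comp r s1 (is_derive_addl 1 s))) (is_derive_exp_linear l s))
    _.
rewrite /wgt -(mulr_powRB1 (ltW s0) r0) -(mulr_powRB1 (ltW s1) r0).
by ring.
Qed.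

Lemma cvg_wgt_primitive_pinfty l : 0 < l ->
  s `^ r * (1 + s) `^ r * expR (- (l * s)) @[s --> +oo] --> (0 : R).
Proof.
move=> l0; have [C C0 HC] := powR1D_expR_bounded (2 * r + 1) l0.
have V0 : (1 + s)^-1 @[s --> +oo] --> (0 : R).
  apply/(gtr0_cvgV0 (f := fun s : R => 1 + s)); last exact: cvg_addrl.
  by near=> s; rewrite ltr_pwDl.
have CV0 : C * (1 + s)^-1 @[s --> +oo] --> (0 : R).
  by rewrite -[X in _ --> X](mulr0 C); apply: cvgM => //; exact: cvg_cst.
apply: (squeeze_cvgr _ (cvg_cst 0) CV0).
near=> s; have s0 : 0 < s by [].
have s1 : 0 < 1 + s by rewrite ltr_pwDl// ltW.
rewrite !mulr_ge0 ?powR_ge0 ?expR_ge0//=.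
rewrite ler_pdivlMr//; apply: le_trans (HC _ (ltW s0)).
have -> : (1 + s) `^ (2 * r + 1) = (1 + s) `^ r * (1 + s) `^ r * (1 + s).
  have -> : 2 * r + 1 = r + (r + 1) by ring.
  rewrite !powRD ?powRr1 ?mulrA ?(ltW s1)//; by apply/implyP => _;
    rewrite gt_eqF.
rewrite mulrAC; apply: ler_wpM2r; first exact: expR_ge0.
apply: ler_wpM2r; first exact: ltW.
apply: ler_wpM2r; first exact: powR_ge0.
by apply: ge0_ler_powR; rewrite ?nnegrE ?(ltW r0) ?(ltW s0) ?(ltW s1)// lerDr.
Unshelve. all: by end_near. Qed.

(** Integration by parts for (s (1 + s))^r e^(- l s), which vanishes at both
    ends.  The derivative of this function has no constant sign, so that
    [ge0_integral_derive] does not apply to it; adding a large multiple C of the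
    envelope makes the integrand nonnegative and contributes exactly C to
    both sides. *)
Lemma wint_recurrence l : 0 < l ->
  r * (wint r 0 l + 2 * wint r 1 l) = l * (wint r 1 l + wint r 2 l).
Proof.
move=> l0.
have [C1 C10 H1] := wgt_le_envelope r 1 l0.
have [C2 C20 H2] := wgt_le_envelope r 2 l0.
pose C := l * (C1 + C2) / r.
pose h s := r * wgt r 0 l s + (2 * r - l) * wgt r 1 l s + (- l) * wgt r 2 l s +
  C * (r * envelope r s).
pose Q s := s `^ r * (1 + s) `^ r * expR (- (l * s)) + C * (s `^ r *
  (1 + s) `^ (- r)).
have dQ s : 0 < s -> is_derive s 1 Q (h s).
  move=> s0; apply: is_derive_eq (is_deriveDf (is_derive_wgt_primitive l s0)
    (is_deriveCf C (is_derive_envelope_primitive r0 s0))) _.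
  by rewrite /h; ring.
have h0 s : 0 < s -> 0 <= h s.
  move=> s0; have e0 := envelope_gt0 r s0.
  have -> : h s = r * wgt r 0 l s + 2 * r * wgt r 1 l s +
    l * ((C1 * envelope r s - wgt r 1 l s) + (C2 * envelope r s - wgt r 2 l s)).
    by rewrite /h /C; field; rewrite gt_eqF.
  have w0 k : 0 <= wgt r k l s by exact: ltW (wgt_gt0 r k l s0).
  have r0' := ltW r0.
  apply: addr_ge0; first by apply: addr_ge0; apply: mulr_ge0 => //;
    exact: mulr_ge0.
  by apply: mulr_ge0; [exact: ltW|apply: addr_ge0; rewrite subr_ge0;
    [exact: H1|exact: H2]].
have ch s : 0 < s -> {for s, continuous h}.
  move=> s0; apply: cvgD; [apply: cvgD; [apply: cvgD|]|];
    apply: cvgM; try exact: cvg_cst; try exact: continuous_wgt.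
  by apply: cvgM; [exact: cvg_cst|exact: continuous_envelope].
have Q0 : Q s @[s --> 0^'+] --> (0 : R).
  rewrite -[X in _ --> X](_ : 0 * expR (- (l * 0)) + C * 0 = 0);
    last by rewrite mul0r mulr0 addr0.
  apply: cvgD.
    apply: cvgM; first exact: cvg_powRM_right0.
    apply: cvg_at_right_filter.
    exact: is_derive_continuous (is_derive_exp_linear l 0).
  by apply: cvgM; [exact: cvg_cst|exact: cvg_powRM_right0].
have Qy : Q s @[s --> +oo] --> (C : R).
  rewrite -[X in _ --> X](_ : 0 + C * 1 = C); last by rewrite mulr1 add0r.
  apply: cvgD; first exact: cvg_wgt_primitive_pinfty.
  by apply: cvgM; [exact: cvg_cst|exact: cvg_envelope_primitive_pinfty].
have /(congr1 fine) := ge0_integral_derive h0 ch dQ Q0 Qy.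
rewrite subr0/= => hC.
have iw k := @integrable_wgt R r r0 k l l0.
have ie := integrableCf r (integrable_envelope r0).
have : \int[mu]_(s in `]0, +oo[) h s =
  r * wint r 0 l + (2 * r - l) * wint r 1 l +
    (- l) * wint r 2 l + C * 1.
  rewrite /h RintegralD//; last 2 first.
  - by do 2 (apply: integrableDf; last exact: integrableCf);
      exact: integrableCf.
  - exact: integrableCf.
  rewrite RintegralD//; last 2 first.
  - by apply: integrableDf; exact: integrableCf.
  - exact: integrableCf.
  rewrite RintegralD//; try exact: integrableCf.
  rewrite (@RintegralZl _ _ _ _ _ _ C)//; rewrite Rintegral_envelope//.
  by rewrite !RintegralZl.
rewrite /Rintegral hC => /eqP; rewrite -subr_eq0 => /eqP HH.
by apply/eqP; rewrite -subr_eq0; apply/eqP; rewrite -oppr0 -HH; ring.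
Qed.

End recurrence.

(** * The single sign change of the balance *)

Section single_crossing.
Context {R : realType}.
Variables r c : R.
Hypotheses (r0 : 0 < r) (c0 : 0 < c).
Implicit Types p x y : R.

(** The exponential rate that appears when the derivative of [phi] is
    rescaled. *)
Definition rate_of p : R := c * (p^-1 + (1 + p)^-1).

Definition drate_of p : R := - c * ((p ^+ 2)^-1 + ((1 + p) ^+ 2)^-1).

(** Its sign is opposite to that of the derivative of [phi r c] at
    (1 + p)^-1, as [dphi_balance] shows. *)
Definition balance p : R := wint r 1 (rate_of p) - p * wint r 0 (rate_of p).

(** The integrating factor of the linear differential equation that [balance]
    satisfies. *)
Definition factor p : R :=
  expR (c * (ln p + ln (1 + p) - p^-1) + 2 * r * ln (rate_of p)).

Definition drift p : R := (r - c) * (2 + (p * (1 + p))^-1) - 1.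

Lemma rate_of_gt0 p : 0 < p -> 0 < rate_of p.
Proof.
by move=> p0; apply: mulr_gt0 => //; apply: addr_gt0;
  rewrite invr_gt0// addr_gt0.
Qed.

Lemma is_derive_rate_of p : 0 < p -> is_derive p 1 rate_of (drate_of p).
Proof.
move=> p0; have p1 : 0 < 1 + p by rewrite addr_gt0.
have V := is_deriveVf (lt0r_neq0 p0) (is_derive_id p 1).
have V1 := is_deriveVf (lt0r_neq0 p1) (is_derive_addl 1 p).
apply: is_derive_eq (is_deriveCf c (is_deriveDf V V1)) _.
by rewrite /drate_of !mul1r; ring.
Qed.

Lemma is_derive_wint_rate_of k p : 0 < p ->
  is_derive p 1 (fun p => wint r k (rate_of p)) (- wint r k.+1 (rate_of p) *
    drate_of p).
Proof.
move=> p0; apply: (@is_derive1_comp _ (wint r k) rate_of).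
  exact/is_derive_wint/rate_of_gt0.
exact: is_derive_rate_of.
Qed.

(** The derivative of [balance] involves the integrals of order 0, 1 and 2.
    Eliminating the one of order 2 by the recurrence leaves a multiple of
    [balance], which [factor] absorbs, and a multiple of the integral of
    order 0, which is positive. *)
Lemma is_derive_factor_balance p : 0 < p ->
  is_derive p 1 (fun p => factor p * balance p)
    (factor p * wint r 0 (rate_of p) * drift p).
Proof.
move=> p0; have p1 : 0 < 1 + p by rewrite addr_gt0.
have k0 := rate_of_gt0 p0.
have V := is_deriveVf (lt0r_neq0 p0) (is_derive_id p 1).
have Dlog := is_deriveDf (is_derive1_ln p0) (is_derive_ln_comp p1
  (is_derive_addl 1 p)).
have Dfac := is_derive_exp_comp (is_deriveDf
  (is_deriveCf c (is_deriveBf Dlog V))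
  (is_deriveCf (2 * r) (is_derive_ln_comp k0 (is_derive_rate_of p0)))).
have Dbal := is_deriveBf (is_derive_wint_rate_of 1 p0)
  (is_deriveMf (is_derive_id p 1) (is_derive_wint_rate_of 0 p0)).
apply: is_derive_eq (is_deriveMf Dfac Dbal) _.
rewrite -/(factor p).
have -> : wint r 2 (rate_of p) =
    r * (wint r 0 (rate_of p) + 2 *
      wint r 1 (rate_of p)) / rate_of p - wint r 1 (rate_of p).
  by rewrite wint_recurrence//; field; rewrite gt_eqF.
move: (factor p) (wint r 0 _) (wint r 1 _) => q I0 I1.
rewrite /drift /drate_of /rate_of.
have p0' := lt0r_neq0 p0; have p1' := lt0r_neq0 p1; have c0' := lt0r_neq0 c0.
have s0' : 1 + p + p != 0 by rewrite lt0r_neq0// addr_gt0.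
by field; rewrite p0' p1' s0' c0'.
Qed.

Lemma drift_decr x y : c < r -> 0 < x -> x < y -> drift y < drift x.
Proof.
move=> cr x0 xy; have y0 := lt_trans x0 xy.
rewrite /drift ltrD2r ltr_pM2l ?subr_gt0// ltrD2l ltf_pV2 ?posrE ?mulr_gt0
  ?addr_gt0//.
by nra.
Qed.

(** For c < r the drift is strictly decreasing; for r <= c it is at most -1. *)
Lemma drift_lt0 x y : 0 < x -> x < y -> drift x <= 0 -> drift y < 0.
Proof.
move=> x0 xy dx; have [rc|cr] := leP r c;
  last exact: lt_le_trans (drift_decr cr x0 xy) dx.
have y0 := lt_trans x0 xy.
have : 0 <= (y * (1 + y))^-1 by rewrite invr_ge0 mulr_ge0// ?addr_ge0// ltW.
by rewrite /drift; nra.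
Qed.

Lemma drift_gt0 x y : 0 < x -> x < y -> 0 < drift y -> 0 < drift x.
Proof.
by move=> x0 xy; apply: contraTT; rewrite -!leNgt => /(drift_lt0 x0 xy)/ltW.
Qed.

Let fb p := factor p * balance p.

Let dfb p : 0 < p -> derivable fb p 1 /\
  (fb^`())%classic p = factor p * wint r 0 (rate_of p) * drift p.
Proof.
move=> p0; have [D H] := is_derive_factor_balance p0.
by split; [exact: D|rewrite derive1E; exact: H].
Qed.

Let fb_within x y : 0 < x -> {within `[x, y], continuous fb}.
Proof.
move=> x0; apply: derivable_within_continuous => z;
  rewrite in_itv/= => /andP[xz _].
by have [] := dfb (lt_le_trans x0 xz).
Qed.

Let fb_decr x y : 0 < x -> x < y -> drift x <= 0 -> fb y < fb x.
Proof.
move=> x0 xy dx.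
have I z : z \in `]x, y[ -> 0 < z /\ x < z.
  by rewrite in_itv/= => /andP[xz _]; split => //; exact: lt_trans xz.
apply: (@ltr0_derive1_decr _ fb x y) => //.
- by move=> z /I[z0 _]; have [] := dfb z0.
- move=> z /I[z0 xz]; have [_ ->] := dfb z0.
  by rewrite pmulr_rlt0 ?(drift_lt0 x0 xz)// mulr_gt0 ?expR_gt0// wint_gt0//
    rate_of_gt0.
- exact: fb_within.
Qed.

Let fb_incr x y : 0 < x -> x < y -> 0 < drift y -> fb x < fb y.
Proof.
move=> x0 xy dy.
have I z : z \in `]x, y[ -> 0 < z /\ z < y.
  by rewrite in_itv/= => /andP[xz ->]; split => //; exact: lt_trans xz.
apply: (@gtr0_derive1_incr _ fb x y) => //.
- by move=> z /I[z0 _]; have [] := dfb z0.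
- move=> z /I[z0 zy]; have [_ ->] := dfb z0.
  by rewrite pmulr_rgt0 ?(drift_gt0 z0 zy)// mulr_gt0 ?expR_gt0// wint_gt0//
    rate_of_gt0.
- exact: fb_within.
Qed.

(** Near 0 the term - c / p of the exponent absorbs 2 r ln (rate_of p), since
    the rate is at most 2 c / p. *)
Lemma factor_bounded : exists2 K, 0 < K & forall p, 0 < p -> p <= 1 ->
  factor p <= K.
Proof.
(* With e = 1 / (4 r), the bound ln z <= z - 1 at z = e * rate_of p gives
   2 r ln (rate_of p) <= rate_of p / 2 + const, and rate_of p <= 2 c / p. *)
pose e := (4 * r)^-1; have e0 : 0 < e by rewrite invr_gt0 mulr_gt0.
exists (expR (c - 2 * r * (1 + ln e))); first exact: expR_gt0.
move=> p p0 p1; rewrite ler_expR.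
have k0 := rate_of_gt0 p0.
have lnp : ln p <= 0 by rewrite ln_le0.
have ln1 : ln (1 + p) <= 1.
  by rewrite (le_trans (@ln_leB1 _ (1 + p) _)) ?addr_gt0// addrAC subrr add0r.
have lnk : ln (rate_of p) <= e * rate_of p - 1 - ln e.
  have := @ln_leB1 _ (e * rate_of p) (mulr_gt0 e0 k0).
  by rewrite lnM ?posrE//; lra.
have ek : 2 * r * (e * rate_of p) <= c * p^-1.
  rewrite /rate_of /e [leLHS](_ : _ = c * (2^-1 * (p^-1 + (1 + p)^-1)));
    last first.
    by field; rewrite !gt_eqF ?addr_gt0.
  rewrite ler_pM2l//.
  have : (1 + p)^-1 <= p^-1 by rewrite lef_pV2 ?posrE ?addr_gt0// lerDr.
  lra.
have h1 : 2 * r * ln (rate_of p) <= 2 * r * (e * rate_of p - 1 - ln e).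
  by rewrite ler_pM2l// mulr_gt0.
have h2 : c * (ln p + ln (1 + p)) <= c by rewrite ger_pMr//; lra.
lra.
Qed.

(** Replaces an analysis of [balance] near 0: all that is needed there is that
    [factor * balance] cannot stay below a negative constant. *)
Lemma factor_balance_lower : exists2 K, 0 < K &
  forall p, 0 < p -> p <= 1 -> - (K * p) <= factor p * balance p.
Proof.
have [K K0 HK] := factor_bounded.
have I0 := wint_gt0 r0 0 c0.
exists (K * wint r 0 c) => [|p p0 p1]; first exact: mulr_gt0.
have k0 := rate_of_gt0 p0.
have ck : c <= rate_of p.
  rewrite ler_pMr//; apply: (@le_trans _ _ p^-1); first by rewrite invf_ge1.
  by rewrite lerDl invr_ge0 addr_ge0// ltW.
have w1 := wint_gt0 r0 1 k0.
have w0 : wint r 0 (rate_of p) <= wint r 0 c := wint_le r0 0 c0 ck.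
have w0' := wint_gt0 r0 0 k0.
have f0 : 0 < factor p := expR_gt0 _.
have h1 : factor p * (p * wint r 0 (rate_of p)) <= K * (p * wint r 0 c).
  by rewrite ler_pM ?HK ?ler_pM ?mulr_ge0// ltW.
have h2 : 0 <= factor p * wint r 1 (rate_of p) by rewrite mulr_ge0// ltW.
rewrite /balance mulrBr.
have -> : K * wint r 0 c * p = K * (p * wint r 0 c) by ring.
lra.
Qed.

(** If [balance] is nonpositive at x, then the drift is nonpositive at x:
    otherwise [factor * balance] would increase on ]0, x], hence stay below
    the negative value it has at x / 2, against its lower bound - K p near 0.
    From x on, the drift is negative and [factor * balance] decreases. *)
Lemma balance_single_crossing x y : 0 < x -> x < y ->
  balance x <= 0 -> balance y < 0.
Proof.
move=> x0 xy bx.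
have f0 p : 0 < factor p := expR_gt0 _.
suff dx : drift x <= 0.
  have := fb_decr x0 xy dx; rewrite /fb => H.
  have : factor y * balance y < 0.
    by apply: lt_le_trans H _; rewrite pmulr_rle0.
  by rewrite pmulr_rlt0.
rewrite leNgt; apply/negP => dx.
have x20 : 0 < x / 2 by rewrite divr_gt0.
have x2x : x / 2 < x by lra.
have fx2 : fb (x / 2) < 0.
  by apply: lt_le_trans (fb_incr x20 x2x dx) _; rewrite /fb pmulr_rle0.
have [K K0 HK] := factor_balance_lower.
(* The last entry of the minimum makes K * t at most - fb (x / 2). *)
pose t := Num.min (Num.min 1 (x / 4)) (- fb (x / 2) / K).
have t0 : 0 < t by rewrite !lt_min ltr01 !divr_gt0// oppr_gt0.
have t1 : t <= 1 by rewrite !ge_min lexx.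
have tx : t < x / 2.
  by apply: (@le_lt_trans _ _ (x / 4)); [rewrite !ge_min lexx orbT|lra].
have tK : K * t <= - fb (x / 2).
  by rewrite mulrC -ler_pdivlMr// !ge_min lexx orbT.
have := HK _ t0 t1; rewrite -/(fb t).
have := fb_incr t0 tx (drift_gt0 x20 x2x dx).
lra.
Qed.

End single_crossing.

(** * The gamma density and distribution function *)

Section gamma_density.
Context {R : realType}.
Notation mu := (@lebesgue_measure R).
Variable r : R.
Hypothesis r0 : 0 < r.
Implicit Types (k : nat) (x y s : R).

Local Notation pdf := (gamma_pdf r 1).

Lemma integrable_power_exp k :
  mu.-integrable `]0, +oo[ (EFin \o (fun x => x ^+ k * (x `^ (r - 1) *
    expR (- x)))).
Proof.
have [C C0 HC] := powR1D_expR_bounded (k%:R + r + 1) (@ltr01 R).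
have mD : measurable (`]0, +oo[%classic : set (measurableTypeR R)) by [].
apply: (le_integrable mD _ _ (integrableCf C (integrable_envelope r0))) => /=.
  apply/measurable_EFinP; apply: measurable_fun_pos => x x0.
  apply: cvgM; first exact: exprn_continuous.
  apply: cvgM; first exact: continuous_powRf.
  exact: continuous_expRN.
move=> x; rewrite in_itv/= andbT => x0.
have x1 : 0 < 1 + x by rewrite addr_gt0.
rewrite lee_fin !ger0_norm; last 2 first.
- by rewrite mulr_ge0 ?(ltW C0)// ltW// envelope_gt0.
- by rewrite !mulr_ge0 ?powR_ge0 ?expR_ge0 ?exprn_ge0// ltW.
apply: le_trans (ler_wpM2r (ltW (envelope_gt0 r x0)) (HC _ (ltW x0))).
have e1 : (1 + x) `^ (k%:R + r + 1) * (1 + x) `^ (- r - 1) = (1 + x) ^+ k.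
  rewrite -powRD; last by apply/implyP => _; rewrite gt_eqF.
  by rewrite -powR_mulrn ?(ltW x1)//; congr (_ `^ _); ring.
rewrite /envelope mul1r.
rewrite [leRHS](_ : _ = (1 + x) `^ (k%:R + r + 1) * (1 + x) `^ (- r - 1) *
  (x `^ (r - 1) * expR (- x))); last by ring.
rewrite e1; apply: ler_wpM2r; first by rewrite mulr_ge0 ?powR_ge0 ?expR_ge0.
by apply: lerXn2r; rewrite ?nnegrE ?(ltW x0) ?(ltW x1)// lerDr.
Qed.

Lemma integrable_gamma_integrand :
  mu.-integrable `]0, +oo[ (EFin \o (fun x => x `^ (r - 1) * expR (- x))).
Proof.
have := integrable_power_exp 0; apply: eq_integrable => // x _.
by rewrite /= mul1r.
Qed.

Lemma gamma_fun_gt0 : 0 < gamma_fun r.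
Proof.
apply: Rintegral_pos_gt0.
  exact: integrable_gamma_integrand.
by move=> x x0; rewrite mulr_gt0 ?powR_gt0 ?expR_gt0.
Qed.

Lemma gamma_pdfE x : 0 < x -> pdf x =
  (gamma_fun r)^-1 * (x `^ (r - 1) * expR (- x)).
Proof.
move=> x0; rewrite /gamma_pdf patchE mem_set/=; last by rewrite in_itv/= x0.
by rewrite powR1 div1r mulN1r mulrA.
Qed.

Lemma gamma_pdf_le0 x : x <= 0 -> pdf x = 0.
Proof.
by move=> x0; rewrite /gamma_pdf patchE memNset//= in_itv/= andbT; apply/negP;
  rewrite -leNgt.
Qed.

Lemma gamma_pdf_gt0 x : 0 < x -> 0 < pdf x.
Proof.
by move=> x0; rewrite gamma_pdfE// !mulr_gt0 ?invr_gt0 ?gamma_fun_gt0 ?powR_gt0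
  ?expR_gt0.
Qed.

Lemma gamma_pdf_ge0 x : 0 <= pdf x.
Proof.
by have [/gamma_pdf_le0 ->//|/gamma_pdf_gt0/ltW] := leP x 0.
Qed.

Lemma continuous_gamma_pdf x : 0 < x -> {for x, continuous pdf}.
Proof.
move=> x0.
have : {for x, continuous (fun y => (gamma_fun r)^-1 * (y `^ (r - 1) *
  expR (- y)))}.
  apply: cvgM; first exact: cvg_cst.
  apply: cvgM; first exact: continuous_powRf.
  exact: continuous_expRN.
rewrite /prop_for /continuous_at -gamma_pdfE//; apply: cvg_trans;
  apply: near_eq_cvg.
near=> y; rewrite gamma_pdfE//.
by near: y; exact: lt_nbhsr.
Unshelve. all: by end_near. Qed.

Lemma integrable_pdf_moment k :
  mu.-integrable `]0, +oo[ (EFin \o (fun x => x ^+ k * pdf x)).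
Proof.
have := integrableCf (gamma_fun r)^-1 (integrable_power_exp k).
apply: eq_integrable => // x; rewrite inE/= in_itv/= andbT => x0.
by congr (_%:E); rewrite gamma_pdfE//; ring.
Qed.

Lemma integrable_pdf : mu.-integrable `]0, +oo[ (EFin \o pdf).
Proof.
have := integrable_pdf_moment 0; apply: eq_integrable => // x _.
by rewrite /= mul1r.
Qed.

Lemma Rintegral_pdf : \int[mu]_(x in `]0, +oo[) pdf x = 1.
Proof.
transitivity (\int[mu]_(x in `]0, +oo[)
    ((gamma_fun r)^-1 * (x `^ (r - 1) * expR (- x)))).
  by apply: eq_Rintegral => x; rewrite inE/= in_itv/= andbT; exact: gamma_pdfE.
rewrite RintegralZl//; last exact: integrable_gamma_integrand.
by rewrite -/(gamma_fun r) mulVf// gt_eqF// gamma_fun_gt0.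
Qed.

Lemma gamma_pdf_bounded (e : R) : 0 < e ->
  exists2 K, 0 < K & forall x, e <= x -> pdf x <= K.
Proof.
move=> e0; have [C C0 HC] := powR1D_expR_bounded r (@ltr01 R).
have g0 := gamma_fun_gt0.
exists ((gamma_fun r)^-1 * (e^-1 * C)); first by rewrite !mulr_gt0 ?invr_gt0.
move=> x ex; have x0 := lt_le_trans e0 ex.
rewrite gamma_pdfE// ler_pM2l ?invr_gt0//.
have -> : x `^ (r - 1) = x^-1 * x `^ r.
  by rewrite -(mulr_powRB1 (ltW x0) r0) mulKf// gt_eqF.
rewrite -mulrA ler_pM ?mulr_ge0 ?powR_ge0 ?expR_ge0 ?invr_ge0 ?(ltW x0)//.
  by rewrite lef_pV2 ?posrE.
apply: le_trans (HC _ (ltW x0)); rewrite mul1r; apply: ler_wpM2r;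
  first exact: expR_ge0.
by apply: ge0_ler_powR; rewrite ?nnegrE ?(ltW r0) ?(ltW x0)// ?addr_ge0 ?(ltW
  x0)// lerDr.
Qed.

(** The density vanishes outside the positive half-line. *)
Lemma integrable_pdfT (A : set (measurableTypeR R)) : measurable A ->
  mu.-integrable A (EFin \o pdf).
Proof.
move=> mA; apply: (@integrableS _ _ _ _ setT) => //.
have /integrable_mkcond -/(_ (measurable_itv _)) := integrable_pdf.
apply: eq_integrable => // x _ /=; rewrite patchE; case: ifPn => //.
rewrite notin_setE/= in_itv/= andbT => /negP; rewrite -leNgt => x0.
by rewrite gamma_pdf_le0.
Qed.

Definition gamma_cdf x : R := \int[mu]_(t in `]-oo, x]) pdf t.

Lemma is_derive_gamma_cdf x : 0 < x -> is_derive x 1 gamma_cdf (pdf x).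
Proof.
move=> x0.
have x1 : x < x + 1 by rewrite ltrDl.
have I1 := @integrable_pdfT `]-oo, x + 1] (measurable_itv _).
have [|dG H] := continuous_FTC1 x1 I1 _ (continuous_gamma_pdf x0).
  by rewrite ltNyr.
by split; [exact: dG|rewrite -derive1E; exact: H].
Qed.

Lemma gamma_cdf_le0 x : x <= 0 -> gamma_cdf x = 0.
Proof.
move=> x0; transitivity (\int[mu]_(t in `]-oo, x]) (cst 0 t : R)).
  by apply: eq_Rintegral => y; rewrite inE/= in_itv/= => yx;
    rewrite gamma_pdf_le0// (le_trans yx).
by rewrite Rintegral_cst ?mul0r.
Qed.

Lemma gamma_cdf_ge0 x : 0 <= gamma_cdf x.
Proof. by apply: Rintegral_ge0 => y _; exact: gamma_pdf_ge0. Qed.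

Lemma gamma_cdf_incr x y : 0 < x -> x < y -> gamma_cdf x < gamma_cdf y.
Proof.
move=> x0 xy; have xz z : z \in `]x, y[ -> 0 < z.
  by rewrite in_itv/= => /andP[xz _]; exact: lt_trans xz.
apply: (@gtr0_derive1_incr _ gamma_cdf x y) => //.
- by move=> z /xz z0; have [] := is_derive_gamma_cdf z0.
- move=> z /xz z0; rewrite derive1E; have [_ ->] := is_derive_gamma_cdf z0.
  exact: gamma_pdf_gt0.
- apply: derivable_within_continuous => z; rewrite in_itv/= => /andP[xz' _].
  by have [] := is_derive_gamma_cdf (lt_le_trans x0 xz').
Qed.

Lemma gamma_cdf_le1 x : gamma_cdf x <= 1.
Proof.
have [x0|x0] := leP x 0; first by rewrite gamma_cdf_le0.
have mD : measurable (`]0, +oo[%classic : set (measurableTypeR R)) by [].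
rewrite /gamma_cdf -[leRHS]Rintegral_pdf [leLHS]Rintegral_mkcond
  [leRHS]Rintegral_mkcond.
apply: le_Rintegral => //.
- have /integrable_mkcond -/(_ (measurable_itv _)) :=
    @integrable_pdfT `]-oo, x] (measurable_itv _).
  by apply: eq_integrable => // y _ /=; rewrite !patchE; case: ifPn.
- have /integrable_mkcond -/(_ (measurable_itv _)) := integrable_pdf.
  by apply: eq_integrable => // y _ /=; rewrite !patchE; case: ifPn.
- move=> y _; rewrite !patchE; case: ifPn => _; case: ifPn => //.
    rewrite notin_setE/= in_itv/= andbT => /negP; rewrite -leNgt => y0.
    by rewrite gamma_pdf_le0.
  by move=> _; exact: gamma_pdf_ge0.
Qed.

Lemma continuous_gamma_cdf x : 0 < x -> {for x, continuous gamma_cdf}.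
Proof. by move=> x0; exact: is_derive_continuous (is_derive_gamma_cdf x0). Qed.

(** Stated away from 0 because the density is unbounded near 0 when r < 1. *)
Lemma gamma_cdf_lipschitz (e : R) : 0 < e -> exists2 K, 0 < K &
  forall x y, e <= x -> x <= y -> gamma_cdf y - gamma_cdf x <= K * (y - x).
Proof.
move=> e0; have [K K0 HK] := gamma_pdf_bounded e0; exists K => // x y ex.
rewrite le_eqVlt => /predU1P[<-|xy]; first by rewrite !subrr mulr0.
have [z zxy ->] : exists2 z, z \in `]x, y[ & gamma_cdf y - gamma_cdf x =
  pdf z * (y - x).
  apply: MVT => //.
  - move=> z; rewrite in_itv/= => /andP[xz _]; apply: is_derive_gamma_cdf.
    exact/(lt_trans _ xz)/(lt_le_trans e0).
  - apply: derivable_within_continuous => z; rewrite in_itv/= => /andP[xz _].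
    by have [] := is_derive_gamma_cdf (lt_le_trans e0 (le_trans ex xz)).
move: zxy; rewrite in_itv/= => /andP[xz _].
by rewrite ler_wpM2r ?subr_ge0 ?(ltW xy)// HK// (le_trans ex)// ltW.
Qed.

End gamma_density.

(** * The distribution function of the combination *)

Section comparison_function.
Context {R : realType}.
Notation mu := (@lebesgue_measure R).
Variable r : R.
Hypothesis r0 : 0 < r.
Implicit Types (c t x y s : R).

Local Notation pdf := (gamma_pdf r 1).
Local Notation cdf := (gamma_cdf r).

Lemma gamma_cdf_nondecreasing : nondecreasing_fun cdf.
Proof.
move=> x y; rewrite le_eqVlt => /predU1P[<-//|xy].
have [x0|x0] := leP x 0; first by rewrite (gamma_cdf_le0 r x0) gamma_cdf_ge0.
exact/ltW/gamma_cdf_incr.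
Qed.

(** Monotonicity gives limits l0 >= 0 and l1 <= 1, and l1 - l0 is the total
    mass 1 of the density. *)
Lemma gamma_cdf_limits :
  cdf x @[x --> 0^'+] --> (0 : R) /\ cdf x @[x --> +oo] --> (1 : R).
Proof.
have ub : has_ubound (range cdf).
  by exists 1 => _ [x _ <-]; exact: gamma_cdf_le1.
have Hy := nondecreasing_cvgr gamma_cdf_nondecreasing ub.
have lb : has_lbound (cdf @` [set` `]0, +oo[]).
  by exists 0 => _ [x _ <-]; exact: gamma_cdf_ge0.
have H0 := @nondecreasing_at_right_cvgr R cdf 0 +oo%O isT
  (fun x y _ _ => @gamma_cdf_nondecreasing x y) lb.
set l1 := sup _ in Hy; set l0 := inf _ in H0.
have := ge0_integral_derive (fun x _ => gamma_pdf_ge0 r0 x)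
  (@continuous_gamma_pdf R r) (is_derive_gamma_cdf r0) H0 Hy.
move=> /(congr1 fine); rewrite -/(Rintegral _ _ _) Rintegral_pdf// => /= l10.
have l11 : l1 <= 1.
  by apply: ge_sup; [exists (cdf 0), 0|move=> _ [x _ <-]; exact: gamma_cdf_le1].
have l00 : 0 <= l0.
  apply: lb_le_inf; last by move=> _ [x _ <-]; exact: gamma_cdf_ge0.
  by exists (cdf 1), 1 => //=; rewrite in_itv/= ltr01.
have l0E : l0 = 0 by lra.
have l1E : l1 = 1 by lra.
by move: H0 Hy; rewrite l0E l1E.
Qed.

(** The probability that X1 <= X2 + t (c - X2), for independent X1 and X2 that
    are gamma distributed with shape r and rate 1. *)
Definition phi c t : R :=
  \int[mu]_(y in `]0, +oo[) (pdf y * cdf (y + t * (c - y))).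

Lemma mix_gt0 c t y : 0 <= c -> 0 <= t -> t < 1 -> 0 < y -> 0 < y + t * (c - y).
Proof. by move=> *; nra. Qed.

Lemma is_derive_mix c t y : is_derive y 1 (fun y => y + t * (c - y)) (1 - t).
Proof.
have H := is_deriveBf (is_derive_cst c y 1) (is_derive_id y 1).
apply: is_derive_eq (is_deriveDf (is_derive_id y 1) (is_deriveCf t H)) _.
by rewrite sub0r mulrN1.
Qed.

Lemma is_derive_mix_weight c t y : is_derive t 1 (fun t => y + t *
  (c - y)) (c - y).
Proof.
have H := is_deriveMf (is_derive_id t 1) (is_derive_cst (c - y) t 1).
apply: is_derive_eq (is_deriveDf (is_derive_cst y t 1) H) _.
by rewrite mul1r mulr0 addr0 add0r.
Qed.

Lemma continuous_phi_integrand c t y : 0 <= c -> 0 <= t -> t < 1 -> 0 < y ->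
  {for y, continuous (fun y => pdf y * cdf (y + t * (c - y)))}.
Proof.
move=> c0 t0 t1 y0; apply: cvgM; first exact: continuous_gamma_pdf.
apply: (@continuous_comp_at _ (fun y => y + t * (c - y)) cdf).
  exact: is_derive_continuous (is_derive_mix c t y).
exact/continuous_gamma_cdf/mix_gt0.
Qed.

Lemma integrable_phi c t : 0 <= c -> 0 <= t -> t < 1 ->
  mu.-integrable `]0, +oo[ (EFin \o (fun y => pdf y * cdf (y + t * (c - y)))).
Proof.
move=> c0 t0 t1.
have mD : measurable (`]0, +oo[%classic : set (measurableTypeR R)) by [].
apply: (le_integrable mD _ _ (integrable_pdf r0)) => /=.
  apply/measurable_EFinP; apply: measurable_fun_pos => y y0.
  exact: continuous_phi_integrand.
move=> y _; rewrite lee_fin normrM ler_piMr// ger0_norm ?gamma_cdf_le1//.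
exact: gamma_cdf_ge0.
Qed.

(** The integrand is the derivative of half the square of the distribution
    function. *)
Lemma phi0 c : 0 <= c -> phi c 0 = 1 / 2.
Proof.
move=> c0; have [G0 Gy] := gamma_cdf_limits.
have H := @ge0_integral_derive R (fun x => 2^-1 * (cdf x * cdf x))
  (fun y => pdf y * cdf (y + 0 * (c - y))) (2^-1 * (0 * 0)) (2^-1 * (1 * 1)).
have {}H : (\int[mu]_(y in `]0%R, +oo[) (pdf y * cdf (y + 0 * (c - y)))%:E =
    (2^-1 * (1 * 1) - 2^-1 * (0 * 0))%:E)%E.
  apply: H.
  - by move=> y y0; rewrite mulr_ge0 ?gamma_pdf_ge0 ?gamma_cdf_ge0.
  - by move=> y y0; apply: continuous_phi_integrand.
  - move=> y y0; have d := is_derive_gamma_cdf r0 y0.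
    apply: is_derive_eq (is_deriveCf 2^-1 (is_deriveMf d d)) _.
    by rewrite mul0r addr0; field.
  - by apply: cvgM; [exact: cvg_cst|exact: cvgM].
  - by apply: cvgM; [exact: cvg_cst|exact: cvgM].
by rewrite /phi /Rintegral H/=; field.
Qed.

Definition dphi c t : R :=
  \int[mu]_(y in `]0, +oo[) (pdf y * (pdf (y + t * (c - y)) * (c - y))).

Lemma is_derive_phi_integrand c t y : 0 <= c -> 0 <= t -> t < 1 -> 0 < y ->
  is_derive t 1 (fun t => pdf y * cdf (y + t * (c - y)))
    (pdf y * (pdf (y + t * (c - y)) * (c - y))).
Proof.
move=> c0 t0 t1 y0; apply: is_deriveCf.
apply: (@is_derive1_comp R cdf (fun t => y + t * (c - y))).
  exact/is_derive_gamma_cdf/mix_gt0.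
exact: is_derive_mix_weight.
Qed.

(** For t' near t the point y + t' (c - y) is at least t c / 2, where the
    density is bounded by some K; this dominates the derivative of the
    integrand by K (c + y) times the density at y. *)
Lemma is_derive_phi c t : 0 < c -> 0 < t -> t < 1 ->
  is_derive t 1 (phi c) (dphi c t).
Proof.
move=> c0 t0 t1.
have mD : measurable (`]0, +oo[%classic : set (measurableTypeR R)) by [].
have e0 : 0 < t / 2 * c by rewrite mulr_gt0// divr_gt0.
have [K K0 HK] := gamma_pdf_bounded r0 e0.
pose g y := K * c * pdf y + K * (y ^+ 1 * pdf y).
have ig0 : mu.-integrable `]0, +oo[ (EFin \o g).
  by apply: integrableDf; apply: integrableCf;
    [exact: integrable_pdf|exact: integrable_pdf_moment].
have ig : mu.-integrable `]0, +oo[ (EFin \o (fun y => `|g y|)).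
  exact: (integrable_norm ig0).
have It : `]t / 2, (1 + t) / 2[%classic t by rewrite /= in_itv/=; lra.
have tI x : `]t / 2, (1 + t) / 2[%classic x -> 0 <= x /\ x < 1.
  by rewrite /= in_itv/=; lra.
have dE x y : 0 <= x -> x < 1 -> 0 < y ->
    partial1of2 (fun t y => pdf y * cdf (y + t * (c - y))) x y =
    pdf y * (pdf (y + x * (c - y)) * (c - y)).
  move=> x0 x1 y0; rewrite partial1of2E.
  by have [_ ->] := is_derive_phi_integrand (ltW c0) x0 x1 y0.
have key := @cvg_differentiation_under_integral R _ _ mu
  (fun t y => pdf y * cdf (y + t * (c - y))) `]0, +oo[ mD
  t (t / 2) ((1 + t) / 2) It _ _ _ (fun s => normr_ge0 _) ig _.
have {key}: h^-1 *: (phi c (h + t) - phi c t) @[h --> 0^'] --> dphi c t.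
  have -> : dphi c t = \int[mu]_(y in `]0, +oo[)
      partial1of2 (fun t y => pdf y * cdf (y + t * (c - y))) t y.
    apply: eq_Rintegral => y; rewrite inE/= in_itv/= andbT => y0.
    by rewrite dE// ltW.
  apply: key.
  - by move=> x /tI[x0 x1]; exact: integrable_phi (ltW c0) x0 x1.
  - move=> x y /tI[x0 x1]; rewrite /= in_itv/= andbT => y0.
    by have [] := is_derive_phi_integrand (ltW c0) x0 x1 y0.
  - move=> x y xI; have [x0 x1] := tI _ xI.
    rewrite /= in_itv/= andbT => y0; rewrite dE//.
    rewrite !normrM (ger0_norm (gamma_pdf_ge0 r0 _)) (ger0_norm (gamma_pdf_ge0
      r0 _)).
    apply: le_trans (ler_norm _).
    rewrite /g expr1 [leRHS](_ : _ = pdf y * (K * (c + y))); last by ring.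
    apply: ler_wpM2l; first exact: gamma_pdf_ge0.
    apply: ler_pM; rewrite ?gamma_pdf_ge0//.
      by apply: HK; move: xI; rewrite /= in_itv/= => /andP[tx _]; nra.
    by rewrite (le_trans (ler_normB _ _))// !ger0_norm// ltW.
exact: cvg_is_derive.
Qed.

End comparison_function.

Section comparison_function_shape.
Context {R : realType}.
Notation mu := (@lebesgue_measure R).
Variable r : R.
Hypothesis r0 : 0 < r.
Implicit Types (c t x y s p : R).

Local Notation pdf := (gamma_pdf r 1).
Local Notation cdf := (gamma_cdf r).

(** When the integral is infinite both sides are 0, as the real-valued integral
    then is 0 by convention. *)
Lemma Rintegral_scale (l : R) (h : R -> R) : 0 < l ->
  measurable_fun (`]0, +oo[%classic : set (measurableTypeR R)) h ->
  (forall x, 0 < x -> 0 <= h x) ->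
  \int[mu]_(x in `]0, +oo[) h x = l * \int[mu]_(x in `]0, +oo[) h (l * x).
Proof.
move=> l0 mh h0; rewrite /Rintegral (ge0_integral_scale l0 mh h0).
case: (integral _ _ _) => [z|/=|/=]; first by [].
- by rewrite gt0_muley ?lte_fin//= mulr0.
- by rewrite gt0_muleNy ?lte_fin//= mulr0.
Qed.

Lemma pdf_product_scale c p s : 0 < c -> 0 < p -> 0 < s ->
  let t := (1 + p)^-1 in let l := c / p in
  pdf (l * s) * pdf (l * s + t * (c - l * s)) =
  (gamma_fun r)^-1 ^+ 2 * (l `^ (r - 1) * (t * c) `^ (r - 1) * expR (- (t *
    c))) *
  wgt r 0 (rate_of c p) s.
Proof.
move=> c0 p0 s0 t l.
have p1 : 0 < 1 + p by rewrite addr_gt0.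
have t0 : 0 < t by rewrite invr_gt0.
have l0 : 0 < l by rewrite divr_gt0.
have s1 : 0 < 1 + s by rewrite addr_gt0.
have -> : l * s + t * (c - l * s) = t * c * (1 + s).
  by rewrite /t /l; field; rewrite !gt_eqF.
have tc0 : 0 < t * c by rewrite mulr_gt0.
rewrite (gamma_pdfE r (mulr_gt0 l0 s0)) (gamma_pdfE r (mulr_gt0 tc0 s1)).
rewrite (powRM _ (ltW l0) (ltW s0)) (powRM _ (ltW tc0) (ltW s1)).
rewrite /wgt.
have -> : expR (- (rate_of c p * s)) = expR (- (l * s)) * expR (- (t * c * s)).
  by rewrite -expRD; congr expR; rewrite /rate_of /l /t; ring.
have -> : expR (- (t * c * (1 + s))) = expR (- (t * c)) * expR (- (t * c * s)).
  by rewrite -expRD; congr expR; ring.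
by ring.
Qed.

Lemma continuous_pdf_product c t y : 0 <= c -> 0 <= t -> t < 1 -> 0 < y ->
  {for y, continuous (fun y => pdf y * pdf (y + t * (c - y)))}.
Proof.
move=> c0 t0 t1 y0; apply: cvgM; first exact: continuous_gamma_pdf.
apply: (@continuous_comp_at _ (fun y => y + t * (c - y)) (gamma_pdf r 1)).
  exact: is_derive_continuous (is_derive_mix c t y).
exact/continuous_gamma_pdf/mix_gt0.
Qed.

Lemma integrable_pdf_product k c t : 0 < c -> 0 < t -> t < 1 ->
  mu.-integrable `]0, +oo[
    (EFin \o (fun y => y ^+ k * (pdf y * pdf (y + t * (c - y))))).
Proof.
move=> c0 t0 t1.
have mD : measurable (`]0, +oo[%classic : set (measurableTypeR R)) by [].
have [K K0 HK] := gamma_pdf_bounded r0 (mulr_gt0 t0 c0).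
apply: (le_integrable mD _ _ (integrableCf K (integrable_pdf_moment r0 k))) =>
  /=.
  apply/measurable_EFinP; apply: measurable_fun_pos => y y0.
  apply: cvgM; first exact: exprn_continuous.
  exact: continuous_pdf_product (ltW c0) (ltW t0) t1 y0.
move=> y; rewrite in_itv/= andbT => y0.
have g0 := gamma_pdf_ge0 r0; have y0' := exprn_ge0 k (ltW y0).
rewrite lee_fin !ger0_norm ?mulr_ge0// ?(ltW K0)//.
rewrite [leRHS](_ : _ = y ^+ k * (pdf y * K)); last by ring.
apply: ler_wpM2l => //; apply: ler_wpM2l => //; apply: HK; nra.
Qed.

(** The substitution y = (c / p) s turns y + t (c - y) into t c (1 + s), so that
    the product of the two densities becomes a constant times
    [wgt r 0 (rate_of c p)]. *)
Lemma dphi_balance c p : 0 < c -> 0 < p -> exists2 M, 0 < M &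
  dphi r c (1 + p)^-1 = - (M * balance r c p).
Proof.
move=> c0 p0; set t := (1 + p)^-1; pose l := c / p.
have p1 : 0 < 1 + p by rewrite addr_gt0.
have t0 : 0 < t by rewrite invr_gt0.
have t1 : t < 1 by rewrite invf_lt1// ltrDl.
have l0 : 0 < l by rewrite divr_gt0.
have k0 := rate_of_gt0 c0 p0.
pose N := (gamma_fun r)^-1 ^+ 2 * (l `^ (r - 1) * (t * c) `^ (r - 1) *
  expR (- (t * c))).
have N0 : 0 < N.
  rewrite /N; apply: mulr_gt0; first by rewrite exprn_gt0// invr_gt0
    gamma_fun_gt0.
  rewrite mulr_gt0 ?expR_gt0// mulr_gt0 ?powR_gt0//; exact: mulr_gt0.
exists (l ^+ 2 * N); first by rewrite mulr_gt0// exprn_gt0.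
pose h k y := y ^+ k * (pdf y * pdf (y + t * (c - y))).
have ih k : mu.-integrable `]0, +oo[ (EFin \o h k) :=
  integrable_pdf_product k c0 t0 t1.
have hE k : \int[mu]_(y in `]0, +oo[) h k y =
  l * (l ^+ k * N * wint r k (rate_of c p)).
  rewrite (Rintegral_scale l0); last 2 first.
  - apply: measurable_fun_pos => y y0; apply: cvgM;
      first exact: exprn_continuous.
    exact: continuous_pdf_product (ltW c0) (ltW t0) t1 y0.
  - by move=> y y0; rewrite !mulr_ge0 ?gamma_pdf_ge0// exprn_ge0// ltW.
  congr (_ * _); rewrite -RintegralZl//; last exact: integrable_wgt.
  apply: eq_Rintegral => s; rewrite inE/= in_itv/= andbT => s0.
  by rewrite /h pdf_product_scale// -/t -/l -/N /wgt exprMn expr0; ring.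
have -> : dphi r c t = c * \int[mu]_(y in `]0, +oo[) h 0 y - \int[mu]_(y in `]0,
  +oo[) h 1 y.
  rewrite -RintegralZl// -RintegralB//; last exact: integrableCf.
  by apply: eq_Rintegral => y _; rewrite /h expr0 expr1; ring.
by rewrite !hE /balance /l; field; rewrite gt_eqF.
Qed.

(** Continuity under the integral sign needs a neighbourhood of 0, whereas the
    integrand is only controlled for t >= 0; the parameter is therefore
    replaced by its square. *)
Lemma cvg_phi_right0 c : 0 < c -> phi r c t @[t --> 0^'+] --> phi r c 0.
Proof.
move=> c0.
have mD : measurable (`]0, +oo[%classic : set (measurableTypeR R)) by [].
(* The square keeps y + t^2 (c - y) positive for y > 0 and -1 < t < 1. *)
pose f t y := pdf y * cdf (y + t ^+ 2 * (c - y)).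
have sq t : `](-1), 1[%classic t -> 0 <= t ^+ 2 /\ t ^+ 2 < 1.
  by rewrite /= in_itv/= => /andP[? ?]; split; [exact: sqr_ge0|nra].
have H : {in (`](-1), 1[%classic : set R), continuous (fun t => \int[mu]_(y in
  `]0, +oo[) f t y)}.
  apply: (@continuity_under_integral R _ _ mu f _ mD (-1) 1 _ _ (gamma_pdf r
    1)).
  - by move=> t /sq[t0 t1]; exact: integrable_phi (ltW c0) t0 t1.
  - apply: aeW => y; rewrite /= in_itv/= andbT => y0 t;
      rewrite inE => /sq[t0 t1].
    apply: cvgM; first exact: cvg_cst.
    apply: (@continuous_comp_at _ (fun t => y + t ^+ 2 * (c - y)) cdf).
      apply: cvgD; first exact: cvg_cst.
      by apply: cvgM; [exact: exprn_continuous|exact: cvg_cst].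
    exact: (continuous_gamma_cdf r0 (mix_gt0 (ltW c0) t0 t1 y0)).
  - exact: integrable_pdf.
  - move=> t _; apply: aeW => y _;
      rewrite normrM (ger0_norm (gamma_pdf_ge0 r0 _)).
    by rewrite ler_piMr ?gamma_pdf_ge0// ger0_norm ?gamma_cdf_le1//
      gamma_cdf_ge0.
have H0 : {for 0, continuous (fun t => \int[mu]_(y in `]0, +oo[) f t y)}.
  by apply: H; rewrite inE/= in_itv/= ltrN10 ltr01.
have S0 : Num.sqrt t @[t --> 0^'+] --> (0 : R).
  by apply: cvg_at_right_filter; rewrite -[X in _ --> X]sqrtr0;
    exact: sqrt_continuous.
have := cvg_comp _ _ S0 H0; rewrite /= {2}/f /phi expr0n/=.
apply: cvg_trans; apply: near_eq_cvg.
by near=> t; rewrite /= /phi /f sqr_sqrtr.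
Unshelve. all: by end_near. Qed.

End comparison_function_shape.

Section comparison_function_half.
Context {R : realType}.
Notation mu := (@lebesgue_measure R).
Variable r : R.
Hypothesis r0 : 0 < r.
Implicit Types (c t u x y p : R).

Local Notation pdf := (gamma_pdf r 1).
Local Notation cdf := (gamma_cdf r).

Lemma dphi_sign c t : 0 < c -> 0 < t -> t < 1 -> exists2 M, 0 < M &
  dphi r c t = - (M * balance r c (t^-1 - 1)).
Proof.
move=> c0 t0 t1; have p0 : 0 < t^-1 - 1 by rewrite subr_gt0 invf_gt1.
have [M M0 HM] := dphi_balance r0 c0 p0; exists M => //.
by rewrite -HM addrC subrK invrK.
Qed.

Lemma phi_derive1 c t : 0 < c -> 0 < t -> t < 1 ->
  derivable (phi r c) t 1 /\ ((phi r c)^`())%classic t = dphi r c t.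
Proof.
move=> c0 t0 t1; have [D H] := is_derive_phi r0 c0 t0 t1.
by split; [exact: D|rewrite derive1E; exact: H].
Qed.

(** If the balance at t is nonpositive, then it is negative for smaller t, and
    [phi r c] increases from the value 1/2 at 0 to its value at t.  Otherwise
    the balance is positive for larger t, and [phi r c] decreases
    from t to u. *)
Lemma phi_gt_half c t u : 0 < c -> 0 < t -> t < u -> u < 1 ->
  1 / 2 <= phi r c u -> 1 / 2 < phi r c t.
Proof.
move=> c0 t0 tu u1 hu; have t1 := lt_trans tu u1; have u0 := lt_trans t0 tu.
have pt0 : 0 < t^-1 - 1 by rewrite subr_gt0 invf_gt1.
have [bt|bt] := leP (balance r c (t^-1 - 1)) 0.
  have I x : x \in `]0, t[ -> [/\ 0 < x, x < t & x < 1].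
    by rewrite in_itv/= => /andP[x0 xt]; split=> //; exact: lt_trans t1.
  rewrite -(phi0 r0 (ltW c0)).
  apply: (@gtr0_derive1_incr _ (phi r c) 0 t) => //.
  - by move=> x /I[x0 xt x1]; have [] := phi_derive1 c0 x0 x1.
  - move=> x /I[x0 xt x1]; have [_ ->] := phi_derive1 c0 x0 x1.
    have [M M0 ->] := dphi_sign c0 x0 x1.
    rewrite oppr_gt0 pmulr_rlt0//.
    apply: (balance_single_crossing r0 c0 pt0) => //.
    by rewrite ltrD2r ltf_pV2.
  - apply/(continuous_within_itvP _ t0); split.
    + move=> x /I[x0 xt x1]; have := is_derive_phi r0 c0 x0 x1.
      exact: is_derive_continuous.
    + exact: cvg_phi_right0.
    + apply: cvg_at_left_filter.
      exact: is_derive_continuous (is_derive_phi r0 c0 t0 t1).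
apply: le_lt_trans hu _.
have I x : x \in `]t, u[ -> [/\ 0 < x, t < x & x < 1].
  by rewrite in_itv/= => /andP[tx xu]; split=> //;
    [exact: lt_trans tx|exact: lt_trans u1].
apply: (@ltr0_derive1_decr _ (phi r c) t u) => //.
- by move=> x /I[x0 xt x1]; have [] := phi_derive1 c0 x0 x1.
- move=> x /I[x0 tx x1]; have [_ ->] := phi_derive1 c0 x0 x1.
  have [M M0 ->] := dphi_sign c0 x0 x1.
  rewrite oppr_lt0 pmulr_rgt0// ltNge; apply/negP => bx.
  have px0 : 0 < x^-1 - 1 by rewrite subr_gt0 invf_gt1.
  have pxt : x^-1 - 1 < t^-1 - 1 by rewrite ltrD2r ltf_pV2.
  have := balance_single_crossing r0 c0 px0 pxt bx.
  by rewrite ltNge (ltW bt).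
- apply: derivable_within_continuous => x; rewrite in_itv/= => /andP[tx xu].
  by have [] := phi_derive1 c0 (lt_le_trans t0 tx) (le_lt_trans xu u1).
Qed.

Lemma phi_lipschitz c t : 0 < c -> 0 < t -> t < 1 -> exists2 K, 0 < K &
  forall c', c / 2 <= c' -> c' <= c -> phi r c t - phi r c' t <= K * (c - c').
Proof.
move=> c0 t0 t1; have e0 : 0 < t * (c / 2) by rewrite mulr_gt0// divr_gt0.
have [K K0 HK] := gamma_cdf_lipschitz r0 e0.
exists (K * t) => [|c' cc c'c]; first exact: mulr_gt0.
have c'0 : 0 <= c' by apply: le_trans cc; rewrite divr_ge0// ltW.
have i1 := integrable_phi r0 (ltW c0) (ltW t0) t1.
have i2 := integrable_phi r0 c'0 (ltW t0) t1.
have mD : measurable (`]0, +oo[%classic : set (measurableTypeR R)) by [].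
rewrite /phi -RintegralB//.
have -> : K * t * (c - c') = \int[mu]_(y in `]0, +oo[) (K * t * (c - c') *
  pdf y).
  by rewrite RintegralZl// ?Rintegral_pdf ?mulr1//; exact: integrable_pdf.
apply: le_Rintegral => //.
- exact: (integrableB mD i1 i2).
- exact/integrableCf/integrable_pdf.
- move=> y; rewrite /= in_itv/= andbT => y0; rewrite -mulrBr mulrC.
  apply: ler_wpM2r; first exact: gamma_pdf_ge0.
  have ey : t * (c / 2) <= y + t * (c' - y) by nra.
  have xy : y + t * (c' - y) <= y + t *
    (c - y) by rewrite lerD2l ler_pM2l// lerD2r.
  have -> : K * t * (c - c') = K * (y + t * (c - y) - (y + t *
    (c' - y))) by ring.
  exact: HK.
Qed.

(** Gives the positivity of the medians: for c = 0 the argument (1 - t) y of the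
    distribution function is smaller than y. *)
Lemma phi_origin_lt_half t : 0 < t -> t < 1 -> phi r 0 t < 1 / 2.
Proof.
move=> t0 t1; rewrite -(phi0 r0 (lexx 0)) -subr_gt0.
have i1 := integrable_phi r0 (lexx 0) (lexx 0) ltr01.
have i2 := integrable_phi r0 (lexx 0) (ltW t0) t1.
have mD : measurable (`]0, +oo[%classic : set (measurableTypeR R)) by [].
rewrite /phi -RintegralB//; apply: Rintegral_pos_gt0.
  exact: (integrableB mD i1 i2).
move=> y y0; rewrite -mulrBr mulr_gt0 ?gamma_pdf_gt0// subr_gt0.
by apply: gamma_cdf_incr => //; nra.
Qed.

End comparison_function_half.

(** * Half-plane probabilities of an independent gamma pair *)

Section change_of_measure.
Context {R : realType}.
Notation mu := (@lebesgue_measure R).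

(** The density is almost everywhere the Radon-Nikodym derivative. *)
Lemma integral_density (nu : probability (measurableTypeR R) R)
    (h f : R -> R) :
  measurable_fun [set: measurableTypeR R] h -> (forall x, 0 <= h x) ->
  mu.-integrable [set: measurableTypeR R] (EFin \o h) ->
  (forall A : set (measurableTypeR R), measurable A ->
    (nu A = \int[mu]_(x in A) (h x)%:E)%E) ->
  measurable_fun [set: measurableTypeR R] f -> (forall x, 0 <= f x <= 1) ->
  (\int[nu]_x (f x)%:E = \int[mu]_x (f x * h x)%:E)%E.
Proof.
move=> mh h0 ih nuE mf f01.
have dom : nu `<< mu.
  apply/null_content_dominatesP => A mA muA0; rewrite nuE//.
  by apply: null_set_integral => //; exact/measurable_funTS/measurable_EFinP.
have inf : nu.-integrable setT (EFin \o f).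
  apply: (@le_integrable _ _ _ nu _ measurableT _ (cst 1%E)) => //.
  - exact/measurable_EFinP.
  - move=> x _ /=; have /andP[f0 f1] := f01 x.
    by rewrite !ger0_norm ?lee_fin.
  - exact: finite_measure_integrable_cst.
rewrite -(Radon_Nikodym_change_of_variables dom)//=.
apply: ae_eq_integral => //.
- apply: emeasurable_funM; first exact/measurable_EFinP.
  apply: (measurable_int mu).
  exact: Radon_Nikodym_integrable.
- by apply/measurable_EFinP; exact: measurable_funM.
- under [X in ae_eq _ _ _ X]eq_fun do rewrite EFinM.
  apply: ae_eqe_mul2l => /=.
  rewrite Radon_NikodymE//=.
  case: cid => /= g [g1 g2 g3].
  apply: integral_ae_eq => //=.
  + exact/measurable_EFinP.
  + by move=> E E01 mE; rewrite -g3//= nuE.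
Qed.

End change_of_measure.

Section law_of_halfplane.
Context {R : realType} {d : measure_display} {T : measurableType d}.
Variables (P : probability T R) (r : R).
Hypothesis r0 : 0 < r.
Notation mu := (@lebesgue_measure R).
Local Notation pdf := (gamma_pdf r 1).
Local Notation cdf := (gamma_cdf r).

Lemma measurable_gamma_pdf : measurable_fun [set: measurableTypeR R] pdf.
Proof. by have /integrableP[/measurable_EFinP] :=
  integrable_pdfT r0 measurableT. Qed.

Lemma measurable_gamma_cdf : measurable_fun [set: measurableTypeR R] cdf.
Proof. by apply: nondecreasing_measurable => //;
  exact: gamma_cdf_nondecreasing. Qed.

Lemma gamma_probE x : gamma_prob r 1 `]-oo, x] = (cdf x)%:E.
Proof.
rewrite /gamma_prob /cdf /Rintegral fineK//.
exact: (integrable_fin_num _ (integrable_pdfT r0 _)).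
Qed.

(** By independence the law of (X2, X1) is the product of the marginal laws;
    its value on the half-plane is the integral over y of the mass that the
    law of X1 gives to the section ]-oo, a + b y]. *)
Lemma probability_halfplane (X1 X2 : T -> measurableTypeR R)
    (mX1 : measurable_fun setT X1) (mX2 : measurable_fun setT X2) (a b : R) :
  (forall A : set (measurableTypeR R), measurable A ->
    P (X1 @^-1` A) = gamma_prob r 1 A) ->
  (forall A : set (measurableTypeR R), measurable A ->
    P (X2 @^-1` A) = gamma_prob r 1 A) ->
  (forall A B : set (measurableTypeR R), measurable A -> measurable B ->
    P (X1 @^-1` A `&` X2 @^-1` B) = (P (X1 @^-1` A) * P (X2 @^-1` B))%E) ->
  P [set w | X1 w <= a + b * X2 w] =
    (\int[mu]_(y in `]0%R, +oo[) (pdf y * cdf (a + b * y))%:E)%E.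
Proof.
move=> h1 h2 h12.
pose Y1 : {mfun T >-> measurableTypeR R} :=
  HB.pack X1 (isMeasurableFun.Build _ _ _ _ _ mX1).
pose Y2 : {mfun T >-> measurableTypeR R} :=
  HB.pack X2 (isMeasurableFun.Build _ _ _ _ _ mX2).
have mW : measurable_fun setT (fun w => (X2 w, X1 w)).
  exact: measurable_fun_pair.
pose W : {mfun T >-> (measurableTypeR R * measurableTypeR R)%type} :=
  HB.pack (fun w => (X2 w, X1 w)) (isMeasurableFun.Build _ _ _ _ _ mW).
pose A := [set z : measurableTypeR R * measurableTypeR R | z.2 <= a + b * z.1].
have mA : measurable A.
  pose g (z : measurableTypeR R * measurableTypeR R) : measurableTypeR R :=
    z.2 - (a + b * z.1).
  have mg : measurable_fun setT g.
    apply: measurable_funB => //; apply: measurable_funD => //.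
    by apply: measurable_funM.
  have -> : A = g @^-1` [set` `]-oo, 0]].
    by apply/seteqP; split => z; rewrite /A /g /= in_itv/= subr_le0.
  by rewrite -[X in measurable X]setTI; exact: mg.
have HU : forall B C : set (measurableTypeR R), measurable B -> measurable C ->
    distribution P W (B `*` C) = (distribution P Y2 B * distribution P Y1 C)%E.
  move=> B C mB mC; rewrite muleC -[RHS]h12//.
  by congr (P _); apply/seteqP; split => w [].
have : P [set w | X1 w <= a + b * X2 w] = distribution P W A by [].
move=> ->; rewrite -(product_measure_unique HU mA).
transitivity (\int[distribution P Y2]_y (cdf (a + b * y))%:E)%E.
  apply: eq_integral => y _; rewrite /= -gamma_probE -h1//;
    congr (P (_ @^-1` _)).
  by apply/seteqP; split => x; rewrite /xsection /A/= inE/= in_itv.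
rewrite (@integral_density _ _ pdf); last 6 first.
- exact: measurable_gamma_pdf.
- exact: gamma_pdf_ge0.
- exact: integrable_pdfT.
- by move=> B mB; exact: h2.
- apply: measurableT_comp; first exact: measurable_gamma_cdf.
  by apply: measurable_funD => //; apply: measurable_funM.
- by move=> x; rewrite gamma_cdf_ge0 ?gamma_cdf_le1.
rewrite [RHS]integral_mkcond; apply: eq_integral => y _; rewrite patchE mulrC.
case: ifPn => //; rewrite notin_setE/= in_itv/= andbT => /negP;
  rewrite -leNgt => y0.
by rewrite gamma_pdf_le0// mul0r.
Qed.

End law_of_halfplane.

(** * Medians *)

Section median.
Context {d : measure_display} {T : measurableType d} {R : realType}.
Variable P : probability T R.
Implicit Types (X : {RV P >-> R}) (x : R).

Lemma Med_lower_bound X : has_lbound [set x : R | ((2^-1)%:E <= cdf X x)%E].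
Proof.
have /fine_cvgP[_] := cvg_cdfNy0 X.
move=> /(cvgr_lt 0)/(_ 2^-1); rewrite invr_gt0 ltr0n => /(_ isT) [M [_ HM]].
exists (M - 1) => x /= hx; rewrite leNgt; apply/negP => xM.
have := HM (M - 1); rewrite ltrBlDr ltrDl ltr01 => /(_ isT) /=.
rewrite ltNge => /negP; apply.
rewrite -lee_fin fineK; last by rewrite ge0_fin_numE ?cdf_ge0// (le_lt_trans
  (cdf_le1 _ _))// ltry.
by apply: le_trans hx _; apply: cdf_nondecreasing; exact: ltW.
Qed.

Lemma Med_nonempty X : [set x : R | ((2^-1)%:E <= cdf X x)%E] !=set0.
Proof.
have /fine_cvgP[_] := cvg_cdfy1 X.
have h : (2^-1 : R) < 1 by rewrite invf_lt1// ltr1n.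
move=> /(cvgr_gt 1)/(_ _ h) [M [_ HM]].
exists (M + 1) => /=; rewrite -(@fineK _ (cdf X (M + 1))); last first.
  by rewrite ge0_fin_numE ?cdf_ge0// (le_lt_trans (cdf_le1 _ _))// ltry.
by rewrite lee_fin ltW// HM// ltrDl.
Qed.

Lemma Med_le X x : ((2^-1)%:E <= cdf X x)%E -> Med X <= x.
Proof. by move=> hx; apply: ge_inf => //; exact: Med_lower_bound. Qed.

(** The infimum in the definition of the median is attained, by right
    continuity of the distribution function. *)
Lemma cdf_Med X : ((2^-1)%:E <= cdf X (Med X))%E.
Proof.
have fin x : cdf X x \is a fin_num.
  by rewrite ge0_fin_numE ?cdf_ge0// (le_lt_trans (cdf_le1 _ _))// ltry.
rewrite leNgt; apply/negP => hm.
have : cdf X x @[x --> (Med X)^'+] --> (fine (cdf X (Med X)))%:E.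
  by rewrite fineK//; exact: cdf_right_continuous.
move=> /fine_cvgP[_] /(cvgr_lt (fine (cdf X (Med X))))/(_ 2^-1).
have hm' : fine (cdf X (Med X)) < 2^-1 by move: hm;
  rewrite -[X in (X < _)%E -> _](fineK (fin _)) lte_fin.
move=> /(_ hm') [e /= e0 He].
have [x Sx xe] : exists2 x, ((2^-1)%:E <= cdf X x)%E & x < Med X + e.
  have /(inf_adherent e0)[x Sx xe] : has_inf [set x : R | ((2^-1)%:E <= cdf X
    x)%E].
    by split; [exact: Med_nonempty|exact: Med_lower_bound].
  by exists x.
have mx : Med X <= x by exact: Med_le.
have [mxE|mx'] := eqVneq (Med X) x; first by move: hm; rewrite mxE ltNge Sx.
have : fine (cdf X x) < 2^-1.
  apply: He; last by rewrite lt_neqAle mx' mx.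
  by rewrite /ball_/= ltr_distlC xe andbT; lra.
by rewrite -lte_fin (fineK (fin _)) ltNge Sx.
Qed.

End median.

Lemma probability_combination (R : realType) (d : measure_display)
    (T : measurableType d) (P : probability T R) (r : R) (X1 X2 : {RV P >-> R})
    (c alpha : R) : 0 < r ->
  gamma_distributed r 1 X1 -> gamma_distributed r 1 X2 ->
    independent_RV X1 X2 ->
  0 <= c -> 2 < alpha ->
  P [set w | X1 w * alpha + X2 w * (2 - alpha) <= 2 * c] =
    (phi r c (2 / alpha))%:E.
Proof.
move=> hr hX1 hX2 hX12 c0 a2; have a0 : 0 < alpha by lra.
set t := 2 / alpha.
have t0 : 0 < t by rewrite divr_gt0.
have t1 : t < 1 by rewrite ltr_pdivrMr// mul1r.
have mX1 : measurable_fun setT (X1 : T -> measurableTypeR R) :=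
  measurable_funPT X1.
have mX2 : measurable_fun setT (X2 : T -> measurableTypeR R) :=
  measurable_funPT X2.
have := probability_halfplane hr mX1 mX2 (t * c) (1 - t) hX1 hX2 hX12.
have -> : [set w | X1 w <= t * c + (1 - t) * X2 w] =
    [set w | X1 w * alpha + X2 w * (2 - alpha) <= 2 * c].
  apply/seteqP; split => w /=.
    move=> /(ler_wpM2r (ltW a0)).
    have -> : (t * c + (1 - t) * X2 w) * alpha = 2 * c + (alpha - 2) * X2 w.
      by rewrite /t; field; rewrite gt_eqF.
    lra.
  move=> h; rewrite -(ler_pM2r a0).
  have -> : (t * c + (1 - t) * X2 w) * alpha = 2 * c + (alpha - 2) * X2 w.
    by rewrite /t; field; rewrite gt_eqF.
  lra.
move=> ->; rewrite /phi /Rintegral fineK; last first.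
  by apply: (integrable_fin_num _ (integrable_phi hr c0 (ltW t0) t1)).
apply: eq_integral => y _; congr ((_ * gamma_cdf r _)%:E); ring.
Qed.

Theorem theorem2p2 (R : realType) (d : measure_display) (T : measurableType d)
    (P : probability T R) (r : R) (hr : 0 < r) (X1 X2 : {RV P >-> R})
    (hX1 : gamma_distributed r 1 X1) (hX2 : gamma_distributed r 1 X2)
    (hX12 : independent_RV X1 X2) :
  let Z (alpha : R) : {RV P >-> R} :=
    alpha \o* X1 \+ (2 - alpha) \o* X2 in
  {in `]2, +oo[ &, {homo (fun alpha => Med (Z alpha)) : a b /~ a < b}}.
Proof.
move=> Z b a; rewrite !in_itv/= !andbT => b2 a2 ab.
have half_lt (x : R) : 0 < x -> x / 2 < x by move=> *; lra.
have half_le (x y k e u v : R) : 0 < k -> e * k = x - 1 / 2 ->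
    x - y <= k * (u - v) -> u - e <= v -> 1 / 2 <= y by move=> *; nra.
have cdfZ (c alpha : R) : 0 <= c -> 2 < alpha ->
    cdf (Z alpha) (2 * c) = (phi r c (2 / alpha))%:E.
  move=> c0 alpha2; rewrite -(probability_combination hr hX1 hX2 hX12 c0
    alpha2).
  by congr (P _); apply/seteqP; split => w /=; rewrite in_itv.
have t01 (alpha : R) : 2 < alpha -> 0 < 2 / alpha /\ 2 / alpha < 1.
  move=> alpha2; have alpha0 : 0 < alpha by lra.
  by rewrite divr_gt0// ltr_pdivrMr// mul1r.
have [ta0 ta1] := t01 _ a2; have [tb0 tb1] := t01 _ b2.
have tba : 2 / b < 2 / a by rewrite ltr_pM2l// ltf_pV2 ?posrE//; lra.
have halfE : (2^-1 : R) = 1 / 2 by rewrite div1r.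
have ma := cdf_Med (Z a).
pose c := Med (Z a) / 2.
have cE : 2 * c = Med (Z a) by rewrite /c; field.
have c0 : 0 < c.
  rewrite ltNge; apply/negP => c0.
  have : ((2^-1)%:E <= cdf (Z a) (2 * 0))%E.
    by apply: le_trans ma _; apply: cdf_nondecreasing; rewrite -cE ler_pM2l.
  by rewrite cdfZ// lee_fin leNgt halfE phi_origin_lt_half.
have ha : 1 / 2 <= phi r c (2 / a).
  by rewrite -halfE -lee_fin -cdfZ ?(ltW c0)// cE.
have hb := phi_gt_half hr c0 tb0 tba ta1 ha.
have [K K0 HK] := phi_lipschitz hr c0 tb0 tb1.
have [e e0 eE] : exists2 e, 0 < e & e * K = phi r c (2 / b) - 1 / 2.
  exists ((phi r c (2 / b) - 1 / 2) / K); first by rewrite divr_gt0// subr_gt0.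
  by rewrite divfK// gt_eqF.
pose c' := Num.max (c / 2) (c - e).
have c'c : c' < c by rewrite gt_max half_lt// gtrBl.
have c'1 : c / 2 <= c' by rewrite le_max lexx.
have c'0 : 0 <= c' by apply: le_trans c'1; rewrite divr_ge0// ltW.
have c'2 : c - e <= c' by rewrite le_max lexx orbT.
have hc' : 1 / 2 <= phi r c' (2 / b).
  exact: half_le K0 eE (HK c' c'1 (ltW c'c)) c'2.
apply: (@le_lt_trans _ _ (2 * c')); last by rewrite -cE ltr_pM2l.
by apply: Med_le; rewrite (cdfZ _ _ c'0 b2) lee_fin halfE.
Qed.
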